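(* Let $V$ be a finite-dimensional real vector space of even dimension, with complexification $V^{\mathbb{C}}$. There is a natural one-to-one correspondence between (i) pluricomplex structures on $V$, and (ii) hypercomplex structures $\tilde K:\mathbb{P}^1\to\mathcal{J}(V^{\mathbb{C}})$, $\zeta\mapsto\tilde J_\zeta$, on (the real vector space underlying) $V^{\mathbb{C}}$, which commute with the intrinsic complex structure $I$ (multiplication by $i$) of $V^{\mathbb{C}}$ and satisfy $$V\cap\{X-i\tilde J_\zeta X:\ X\in V^{\mathbb{C}}\}=0\quad\text{for all }\zeta\in\mathbb{P}^1 .$$
   Context: For a real vector space $U$ of dimension $2n$, $\mathcal{J}(U)$ is the space of complex structures on $U$, regarded as an open subset of $\mathrm{Gr}_n(U^{\mathbb{C}})$ via $J\mapsto U^{1,0}(J)=\{X-iJX: X\in U\}$; $\mathcal{U}^{1,0}\to\mathcal{J}(U)$ is the tautological bundle with fibre $U^{1,0}(J)$. A pluricomplex structure on $U$ is a holomorphic map $K:\mathbb{P}^1\to\mathcal{J}(U)$ such that $K^*\mathcal{U}^{1,0}\simeq\mathcal{O}(-1)\otimes\mathbb{C}^n$ and $U^{\mathbb{C}}/K^*\mathcal{U}^{1,0}\simeq\mathcal{O}(1)\otimes\mathbb{C}^n$. A hypercomplex structure is a pluricomplex structure whose complex structures $J_\zeta$, $\zeta\in\mathbb{P}^1\simeq S^2$, are the unit imaginary quaternions of a quaternionic module structure on $U$; equivalently a pluricomplex structure satisfying $J_{-1/\bar\zeta}=-J_\zeta$ for all $\zeta$. The correspondence: given a pluricomplex structure $K$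 on $V$ with $V^{1,0}_\zeta=V^{1,0}(K(\zeta))$, one has $V^{\mathbb{C}}=V^{1,0}_\zeta\oplus V^{1,0}_{-1/\bar\zeta}$ for each $\zeta$, and $\tilde J_\zeta(v_1+v_2)=i(v_1-v_2)$ for $v_1\in V^{1,0}_\zeta$, $v_2\in V^{1,0}_{-1/\bar\zeta}$. Conversely, from $\tilde K$ the complex structure $J_\zeta$ on $V$ is the one with $V^{1,0}_\zeta=\{X-i\tilde J_\zeta X: X\in V^{\mathbb{C}}\}$, where $i$ denotes the intrinsic multiplication on $V^{\mathbb{C}}$. *)

(* Defs.v *)
From HB Require Import structures.
From mathcomp Require Import all_boot all_order all_algebra.
From mathcomp Require Import complex.
From mathcomp Require Import all_classical all_reals all_analysis.

Set Implicit Arguments.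
Unset Strict Implicit.
Unset Printing Implicit Defensive.

Import Order.TTheory GRing.Theory Num.Theory.
Import numFieldNormedType.Exports.
Local Open Scope classical_set_scope.
Local Open Scope complex_scope.
Local Open Scope ring_scope.

(* The complexification of V: the pair (x, y) is x + i y. The carrier is that
   of V * V, whose library structure of vectType R is the underlying real
   vector space. *)
Definition cplx (R : realType) (V : vectType R) : Type := (V * V)%type.

Section ComplexificationInstances.
Import VectorInternalTheory.
Variables (R : realType) (V : vectType R).
Implicit Types (a b : R[i]) (u v : cplx V).

HB.instance Definition _ := GRing.Zmodule.copy (cplx V) (V * V)%type.

Definition cplx_scale a v : cplx V :=
  (complex.Re a *: v.1 - complex.Im a *: v.2,
   complex.Re a *: v.2 + complex.Im a *: v.1).

Fact cplx_scaleA a b v : cplx_scale a (cplx_scale b v) = cplx_scale (a * b) v.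
Proof.
case: a b v => [a1 a2] [b1 b2] [x y]; rewrite /cplx_scale /=; congr pair.
  rewrite !scalerBr !scalerDr !scalerA !scalerBl !scalerDl !opprD.
  by rewrite [X in _ + X = _]addrC addrACA.
rewrite !scalerBr !scalerDr !scalerA !scalerBl !scalerDl.
by rewrite [X in _ + X = _]addrC addrACA.
Qed.

Fact cplx_scale1 : left_id 1 cplx_scale.
Proof.
by case=> x y; rewrite /cplx_scale /= !scale1r !scale0r subr0 addr0.
Qed.

Fact cplx_scaleDr : right_distributive cplx_scale +%R.
Proof.
move=> [a1 a2] [x y] [x' y']; rewrite /cplx_scale /=.
congr pair; rewrite !scalerDr ?opprD addrACA //.
Qed.

Fact cplx_scaleDl v : {morph cplx_scale^~ v : a b / a + b}.
Proof.
move=> [a1 a2] [b1 b2]; case: v => x y; rewrite /cplx_scale /=.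
congr pair; rewrite !scalerDl ?opprD addrACA //.
Qed.

HB.instance Definition _ := GRing.Zmodule_isLmodule.Build R[i] (cplx V)
  cplx_scaleA cplx_scale1 cplx_scaleDr cplx_scaleDl.

Let v2rP (a b : R) (x y z : V) j :
  v2r (a *: x + b *: y + z) 0 j =
  a * v2r x 0 j + b * v2r y 0 j
  + v2r z 0 j.
Proof. by rewrite !raddfD /= !linearZ /= !mxE. Qed.

Fact cplx_vect_axiom : Vector.axiom (dim V) (cplx V).
Proof.
pose f (v : cplx V) : 'rV[R[i]]_(dim V) :=
  \row_j (v2r v.1 0 j +i* v2r v.2 0 j).
pose g (w : 'rV[R[i]]_(dim V)) : cplx V :=
  (r2v (\row_j complex.Re (w 0 j)),
   r2v (\row_j complex.Im (w 0 j))).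
exists f.
  move=> [a1 a2] [x y] [x' y']; apply/rowP => j; rewrite !mxE /=.
  by rewrite -scaleNr !v2rP mulNr.
exists g => [[x y]|w].
  by congr pair; apply: v2r_inj;
    rewrite r2vK; apply/rowP => j; rewrite !mxE.
apply/rowP => j; rewrite mxE /= !r2vK !mxE.
by case: (w 0 j).
Qed.

HB.instance Definition _ := Lmodule_hasFinDim.Build R[i] (cplx V) cplx_vect_axiom.
End ComplexificationInstances.

Section Definitions.
Variable R : realType.
Local Notation C := R[i].

Definition of_real (V : vectType R) (x : V) : cplx V := (x, 0).

(* P^1 as the Riemann sphere C + {oo}, with None = oo; the affine coordinates
   are zeta over [chart0] and 1 / zeta over [chart1]. *)
Definition P1 := option C.
Definition chart0 (z : C) : P1 := Some z.
Definition chart1 (w : C) : P1 := if w == 0 then None else Some w^-1.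
Definition antipode (p : P1) : P1 :=
  if p is Some z then chart1 (- z^*) else Some 0.

(* Every linear coordinate is complex differentiable on a neighbourhood. *)
Definition holomorphic_at (W : vectType C) (f : C -> W) (z : C) : Prop :=
  \forall w \near (z : C^o), forall l : 'Hom(W, C^o),
    derivable (fun t : C^o => l (f t)) w 1.

Definition holomorphic (W : vectType C) (f : C -> W) : Prop :=
  forall z, holomorphic_at f z.

(* Holomorphic maps to the Grassmannian of n-planes in W, in its standard
   charts: a splitting W = A + B with \dim A = n identifies Hom(A, B) with the
   n-planes complementary to B, by taking graphs. *)
Definition graph (W : vectType C) (A B : {vspace W})
    (L : 'Hom(subvs_of A, subvs_of B)) : set W :=
  [set vsval a + vsval (L a) | a in [set: subvs_of A]].

Definition holomorphic_to_Gr (W : vectType C) (n : nat) (E : C -> set W) : Prop :=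
  forall z0, exists A B : {vspace W},
    [/\ (A + B = fullv)%VS, (A :&: B = 0)%VS, \dim A = n &
     exists2 L : C -> 'Hom(subvs_of A, subvs_of B),
       holomorphic_at L z0 & \forall z \near (z0 : C^o), E z = graph (L z)].

(* O(k) (x) C^n is glued from two copies of C x C^n, lying over the two charts,
   by identifying (z, v) over chart0 with (z^-1, z^(-k) v) over chart1.
   In particular O(-1) is the tautological line bundle, with the frame (1, z)
   over chart0 and (w, 1) over chart1. *)
Definition iso_from_O (k : int) (n : nat) (W : vectType C) (E : P1 -> set W) :
    Prop :=
  exists f0 f1 : C -> 'Hom('rV[C]_n, W),
    [/\ holomorphic f0, holomorphic f1,
        forall z, z != 0 -> forall v, f0 z v = f1 z^-1 (z ^ (- k) *: v),
        forall z, injective (f0 z) /\ range (f0 z) = E (chart0 z) &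
        forall w, injective (f1 w) /\ range (f1 w) = E (chart1 w)].

(* The quotient of the trivial bundle W by the subbundle E is isomorphic to
   O(k) (x) C^n: bundle maps out of W / E are the bundle maps out of W that
   vanish on E, so that such an isomorphism is a fibrewise surjective
   holomorphic map W -> O(k) (x) C^n with kernel E. *)
Definition quotient_iso_to_O (k : int) (n : nat) (W : vectType C)
    (E : P1 -> set W) : Prop :=
  exists g0 g1 : C -> 'Hom(W, 'rV[C]_n),
    [/\ holomorphic g0, holomorphic g1,
        forall z, z != 0 -> forall u, g1 z^-1 u = z ^ (- k) *: g0 z u,
        forall z, range (g0 z) = setT /\ [set u | g0 z u = 0] = E (chart0 z) &
        forall w, range (g1 w) = setT /\ [set u | g1 w u = 0] = E (chart1 w)].

Section RealVectorSpace.
Variable U : vectType R.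

Definition complex_structure (J : 'End(U)) : Prop := (J \o J = - \1)%VF.

(* U^{1,0}(J) *)
Definition T10 (J : 'End(U)) : set (cplx U) :=
  [set of_real x - 'i%C *: of_real (J x) | x in [set: U]].

Record pluricomplex (K : P1 -> 'End(U)) : Prop := {
  pluri_cs : forall p, complex_structure (K p);
  pluri_hol0 : holomorphic_to_Gr (\dim {:U})./2 (fun z => T10 (K (chart0 z)));
  pluri_hol1 : holomorphic_to_Gr (\dim {:U})./2 (fun w => T10 (K (chart1 w)));
  pluri_sub : iso_from_O (- 1) (\dim {:U})./2 (fun p => T10 (K p));
  pluri_quo : quotient_iso_to_O 1 (\dim {:U})./2 (fun p => T10 (K p)) }.

(* A (left) quaternionic module structure, given by the actions of i, j, k. *)
Record quaternionic (I1 I2 I3 : 'End(U)) : Prop := {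
  quat_1 : (I1 \o I1 = - \1)%VF;
  quat_2 : (I2 \o I2 = - \1)%VF;
  quat_12 : (I1 \o I2 = I3)%VF;
  quat_21 : (I2 \o I1 = - I3)%VF }.

(* P^1 = S^2: inverse of the stereographic projection
   (x, y, t) |-> (x + i y) / (1 - t) from the north pole. It carries the
   antipode of P^1 to that of S^2. *)
Definition sphere (p : P1) : R * R * R :=
  if p is Some (x +i* y) then
    let s := x ^+ 2 + y ^+ 2 in
    (2 * x / (s + 1), 2 * y / (s + 1), (s - 1) / (s + 1))
  else (0, 0, 1).

Definition hypercomplex (K : P1 -> 'End(U)) : Prop :=
  pluricomplex K /\
  exists I1 I2 I3 : 'End(U), quaternionic I1 I2 I3 /\
    forall p, let: (a, b, c) := sphere p in
      K p = a *: I1 + b *: I2 + c *: I3.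

End RealVectorSpace.

Section Correspondence.
Variable V : vectType R.

(* The real vector space underlying V^C, and its real endomorphisms acting on
   the complex vector space V^C. *)
Definition realif : vectType R := (V * V)%type.
Definition act (J : 'End(realif)) (v : cplx V) : cplx V := J v.

(* {X - i J X : X in V^C}, with i the intrinsic multiplication of V^C. *)
Definition intrinsic_T10 (J : 'End(realif)) : set (cplx V) :=
  [set X - 'i%C *: act J X | X in [set: cplx V]].

Record transverse_hypercomplex (Kt : P1 -> 'End(realif)) : Prop := {
  th_hyper : hypercomplex Kt;
  th_comm : forall p X, act (Kt p) ('i%C *: X) = 'i%C *: act (Kt p) X;
  th_transverse : forall p,
    range (@of_real V) `&` intrinsic_T10 (Kt p) = [set 0] }.

Definition direct_sum (W : zmodType) (A B : set W) : Prop :=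
  forall v, exists! w : W * W, [/\ A w.1, B w.2 & v = w.1 + w.2].

End Correspondence.
End Definitions.

(* Main.v *)
Require Import Defs.
From HB Require Import structures.
From mathcomp Require Import all_boot all_order all_algebra.
From mathcomp Require Import complex.
From mathcomp Require Import all_classical all_reals all_analysis.
From mathcomp Require Import ring lra.
Set Implicit Arguments.
Unset Strict Implicit.
Unset Printing Implicit Defensive.
Import Order.TTheory GRing.Theory Num.Theory.
Import numFieldNormedType.Exports.
Local Open Scope classical_set_scope.
Local Open Scope complex_scope.
Local Open Scope ring_scope.

(** A pluricomplex structure is a linear pencil of subspaces, and a linear
    pencil is the same thing as a decomposition of a complex vector space [W]
    as C^2 (x) C^n, which is also what a complex-linear quaternionic structure
    on [W] is.

    From a pluricomplex structure to a pencil: a trivialisation of the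
    subbundle as O(-1) (x) C^n consists of entire maps [f0], [f1] into
    Hom(C^n, V^C) with f0(z) = z f1(1/z), hence f0(z) = A + z B for constant
    [A] and [B], because sections of O(1) are affine (Liouville,
    [section_O1_affine_vect]). In the same way the quotient is described by
    P + z Q. Exactness for every z gives PA = 0, QB = 0 and PB = - QA, and PB is
    invertible: on its kernel [B] factors through [A], and an eigenvector of the
    factor would make some A + z B degenerate. So V^C = im A (+) im B
    ([frame_of_pencil]), that is V^C = C^2 (x) C^n with the fibre over z equal
    to the line spanned by (1, z), tensored with C^n. The fibre over the
    antipode is the orthogonal line, which gives the direct sum decomposition;
    the operator equal to i on the first summand and to -i on the second one is
    then the unit imaginary quaternion that z stands for, in the standard action
    on C^2 ([eigenset_pencil]).

    From quaternions to a pencil: if J1, J2, J3 are complex-linear and satisfy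
    the quaternion relations, the involution -i J1 exchanges the two eigenspaces
    of J3, which identifies [W] with C^2 (x) C^n ([cquat_frame]); the
    i-eigenspaces of the unit imaginary quaternions then form a pencil, and the
    bundle conditions can be read off from it ([frame_graph_holomorphic],
    [frame_sub_iso], [frame_quotient_iso]). This is used twice: for V^C with its
    intrinsic complex structure, to pass from the hypercomplex structure to the
    pluricomplex one, and for the complexification of the real space underlying
    V^C, to see that the hypercomplex structure built from a pluricomplex one is
    itself pluricomplex. The condition that V meets no eigenspace is what makes
    each eigenspace the (1,0)-space of a complex structure on V
    ([real_structure]).

    The theorem of Liouville is proved with trapezoid sums in place of contour
    integrals: Goursat's bisection bounds them around quadrilaterals, and only
    the sums for 1 / z have to be compared, never computed. *)

(** * Trapezoid sums *)

Section Trapezoid.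
Variable C : numClosedFieldType.
Implicit Types (f g : C -> C) (a b c d u : C) (m : nat).

Definition midpoint a b : C := (a + b) / 2%:R.

(** The trapezoid rule with 2 ^ m steps for the integral of [f] on the segment
    from [a] to [b]. Refining by bisection makes the sums additive under
    splitting a segment at its midpoint, so that Goursat's argument applies to
    them without any integral. *)
Fixpoint trapezoid m f a b : C :=
  if m is m'.+1 then trapezoid m' f a (midpoint a b) + trapezoid m' f (midpoint a b) b
  else (f a + f b) / 2%:R * (b - a).

Lemma trapezoid_rev m f a b : trapezoid m f b a = - trapezoid m f a b.
Proof.
elim: m a b => [|m IH] a b /=; first by ring.
have -> : midpoint b a = midpoint a b by rewrite /midpoint addrC.
by rewrite (IH (midpoint a b) b) (IH a); ring.
Qed.

(** The rule is exact on affine functions. *)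
Lemma trapezoid_affine m u v a b :
  trapezoid m (fun z => u + v * z) a b = trapezoid 0 (fun z => u + v * z) a b.
Proof.
elim: m a b => [//|m IH] a b; rewrite [LHS]/= !IH /= /midpoint.
by field.
Qed.

Lemma trapezoid_scale m f u a b :
  trapezoid m f (u * a) (u * b) = trapezoid m (fun z => u * f (u * z)) a b.
Proof.
elim: m a b => [|m IH] a b /=; first by ring.
have -> : midpoint (u * a) (u * b) = u * midpoint a b by rewrite /midpoint; ring.
by rewrite !IH.
Qed.

Lemma trapezoidZ m f u a b : trapezoid m (fun z => u * f z) a b = u * trapezoid m f a b.
Proof. by elim: m a b => [|m IH] a b /=; rewrite ?IH; ring. Qed.

Lemma midpoint_dist a b : `|midpoint a b - a| = `|b - a| / 2%:R /\ `|b - midpoint a b| =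
    `|b - a| / 2%:R.
Proof.
have E x : `|x / 2%:R| = `|x| / 2%:R :> C by rewrite normrM normfV normr_nat.
by split; rewrite -E; congr `|_|; rewrite /midpoint; field.
Qed.

(** The convexity of the domain [D] is needed for midpoints only: the sums
    sample the functions at the end points and at iterated midpoints. *)
Lemma trapezoid_close m f g (D : C -> Prop) eta a b :
  (forall x y, D x -> D y -> D (midpoint x y)) ->
  (forall x, D x -> `|f x - g x| <= eta) -> D a -> D b ->
  `|trapezoid m f a b - trapezoid m g a b| <= eta * `|b - a|.
Proof.
move=> mid fg; elim: m a b => [|m IH] a b Da Db /=.
  rewrite (_ : _ - _ = (f a - g a + (f b - g b)) / 2%:R * (b - a)); last by field.
  rewrite normrM ler_wpM2r // normrM normfV normr_nat ler_pdivrMr ?ltr0n //.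
  by rewrite mulr_natr mulr2n (le_trans (ler_normD _ _)) // lerD // fg.
rewrite opprD addrACA (le_trans (ler_normD _ _)) //.
have [E1 E2] := midpoint_dist a b.
rewrite [leRHS](_ : _ = eta * `|midpoint a b - a| + eta * `|b - midpoint a b|).
  by apply: lerD; apply: IH => //; apply: mid.
by rewrite E1 E2; field.
Qed.

Definition contour m f a b c d :=
  trapezoid m f a b + trapezoid m f b c + trapezoid m f c d + trapezoid m f d a.

(** The sides of the four small quadrilaterals that lie inside the large one
    are run through twice, in opposite directions. *)
Lemma contour_split m f a b c d (o := (a + b + c + d) / 4%:R) :
  contour m.+1 f a b c d =
    contour m f a (midpoint a b) o (midpoint d a)
    + contour m f (midpoint a b) b (midpoint b c) o
    + contour m f o (midpoint b c) c (midpoint c d)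
    + contour m f (midpoint d a) o (midpoint c d) d.
Proof.
rewrite /contour /=.
rewrite (trapezoid_rev _ _ (midpoint a b) o) (trapezoid_rev _ _ (midpoint b c) o).
rewrite (trapezoid_rev _ _ o (midpoint c d)) (trapezoid_rev _ _ (midpoint d a) o).
ring.
Qed.

(** The sum of an affine function around a closed contour vanishes. *)
Lemma contour_affine_close m f u v (D : C -> Prop) eta l a b c d :
  (forall x y, D x -> D y -> D (midpoint x y)) ->
  (forall x, D x -> `|f x - (u + v * x)| <= eta) ->
  D a -> D b -> D c -> D d ->
  [/\ `|b - a| <= l, `|c - b| <= l, `|d - c| <= l & `|a - d| <= l] ->
  `|contour m f a b c d| <= 4%:R * (eta * l).
Proof.
move=> mid fD Da Db Dc Dd [ab bc cd da].
pose g z := u + v * z.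
have eta0 : 0 <= eta by apply: le_trans (fD a Da).
have E x y : D x -> D y -> `|y - x| <= l ->
    `|trapezoid m f x y - trapezoid m g x y| <= eta * l.
  move=> Dx Dy xy; apply: le_trans (ler_wpM2l eta0 xy).
  by apply: (trapezoid_close m mid).
have g0 : contour m g a b c d = 0.
  by rewrite /contour !trapezoid_affine /= /g; field.
rewrite -[X in `|X|]subr0 -[X in _ - X]g0 /contour.
rewrite 3!opprD !addrA.
rewrite (_ : _ - _ = trapezoid m f a b - trapezoid m g a b + (trapezoid m f b c - trapezoid
    m g b c) + (trapezoid m f c d - trapezoid m g c d) + (trapezoid m f d a - trapezoid m g
    d a)); last by ring.
rewrite (_ : 4%:R * _ = eta * l + eta * l + eta * l + eta * l); last by ring.
do 3 ?[apply: le_trans (ler_normD _ _) _; apply: lerD]; exact: E.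
Qed.

End Trapezoid.

(** * Bisection *)

Section Bisection.
Variable R : realType.
Local Notation C := R[i].

(** The sequences [x n - l / 2 ^ n] and [x n + l / 2 ^ n] are monotone and
    enclose the limit. *)
Lemma dyadic_limit (x : nat -> R) (l : R) :
  (forall n, `|x n.+1 - x n| <= l / 2%:R ^+ n.+1) ->
  exists y, forall n, `|y - x n| <= l / 2%:R ^+ n.
Proof.
move=> xl.
pose lo n := x n - l / 2%:R ^+ n; pose hi n := x n + l / 2%:R ^+ n.
have half n : l / 2%:R ^+ n = 2%:R * (l / 2%:R ^+ n.+1).
  by rewrite exprS; field; rewrite expf_neq0.
have lo_nd : nondecreasing_seq lo.
  apply/nondecreasing_seqP => n; rewrite /lo (half n).
  by have := xl n; rewrite ler_norml => /andP[? ?]; lra.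
have hi_ni : nonincreasing_seq hi.
  apply/nonincreasing_seqP => n; rewrite /hi (half n).
  by have := xl n; rewrite ler_norml => /andP[? ?]; lra.
have l0 : 0 <= l.
  have := le_trans (normr_ge0 _) (xl 0%N).
  by rewrite pmulr_lge0 // invr_gt0 exprn_gt0.
have lohi n m : lo n <= hi m.
  apply: (le_trans (lo_nd _ _ (leq_maxl n m))).
  apply: (le_trans _ (hi_ni _ _ (leq_maxr n m))).
  rewrite /lo /hi; set t := l / _.
  have : 0 <= t by rewrite divr_ge0 // exprn_ge0.
  lra.
exists (sup (range lo)) => n.
have lo_sup : has_sup (range lo).
  split; first by exists (lo 0%N), 0%N.
  by exists (hi 0%N) => _ [m _ <-]; apply: lohi.
have h1 : lo n <= sup (range lo) by apply: ub_le_sup; [case: lo_sup|exists n].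
have h2 : sup (range lo) <= hi n.
  apply: ge_sup; first by case: lo_sup.
  by move=> _ [m _ <-]; apply: lohi.
rewrite ler_norml; rewrite /lo /hi in h1 h2; lra.
Qed.

Lemma normc_Re_le (z : C) (r : R) : `|z| <= r%:C -> `|complex.Re z| <= r.
Proof. by case: z => x y; rewrite normc_def lecR; apply: le_trans; rewrite -sqrtr_sqr
    ler_wsqrtr // lerDl sqr_ge0. Qed.

Lemma normc_Im_le (z : C) (r : R) : `|z| <= r%:C -> `|complex.Im z| <= r.
Proof. by case: z => x y; rewrite normc_def lecR; apply: le_trans; rewrite -sqrtr_sqr
    ler_wsqrtr // lerDr sqr_ge0. Qed.

Lemma normc_le_ReIm (x y : R) : `|x +i* y| <= (`|x| + `|y|)%:C.
Proof.
rewrite normc_def lecR /= -[leRHS]ger0_norm ?addr_ge0 // -sqrtr_sqr ler_wsqrtr //.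
by rewrite sqrrD !real_normK ?num_real // lerD2r lerDl mulrn_wge0 // mulr_ge0.
Qed.

(** The limit argument of a proof by successive bisection, for cells of any
    type: the base points [c q] of successive bad cells move by geometrically
    decreasing amounts, hence converge. *)
Lemma bisection (T : Type) (bad : nat -> T -> Prop) (c : T -> C) (l : R) (q0 : T) :
  (forall n q, bad n q ->
     exists2 q', bad n.+1 q' & `|c q' - c q| <= (l / 2%:R ^+ n.+1)%:C) ->
  bad 0%N q0 ->
  exists z, forall n, exists2 q, bad n q & `|z - c q| <= (2%:R * (l / 2%:R ^+ n))%:C.
Proof.
move=> step bad0.
have [next nextP] : {f : nat * T -> T & forall nq, bad nq.1 nq.2 ->
    bad nq.1.+1 (f nq) /\ `|c (f nq) - c nq.2| <= (l / 2%:R ^+ nq.1.+1)%:C}.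
  apply: (@choice _ _ (fun nq q' => bad nq.1 nq.2 ->
    bad nq.1.+1 q' /\ `|c q' - c nq.2| <= (l / 2%:R ^+ nq.1.+1)%:C)) => -[n q] /=; have
        [/step[q' ? ?]|nb] := pselect (bad n q); first by exists q'.
  by exists q.
pose q_ := fix q_ n := if n is m.+1 then next (m, q_ m) else q0.
have badq n : bad n (q_ n) by elim: n => [//|n IH] /=; case: (nextP (n, q_ n) IH).
have dq n : `|c (q_ n.+1) - c (q_ n)| <= (l / 2%:R ^+ n.+1)%:C.
  by case: (nextP (n, q_ n) (badq n)).
have [x xP] : exists x, forall n, `|x - complex.Re (c (q_ n))| <= l / 2%:R ^+ n.
  by apply: dyadic_limit => n; rewrite -raddfB; apply: normc_Re_le.
have [y yP] : exists y, forall n, `|y - complex.Im (c (q_ n))| <= l / 2%:R ^+ n.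
  by apply: dyadic_limit => n; rewrite -raddfB; apply: normc_Im_le.
exists (x +i* y) => n; exists (q_ n) => //.
have := xP n; have := yP n; case: (c (q_ n)) => u v /= yv xu.
apply: le_trans (normc_le_ReIm _ _) _; rewrite lecR; lra.
Qed.

End Bisection.

(** * The theorem of Goursat on quadrilaterals *)

(** The form in which complex differentiability is used: no continuity of the
    derivative is available, only an affine approximation at each point. *)
Lemma derivable_affine_approx (K : numFieldType) (f : K^o -> K^o) (z : K^o) :
  derivable f z 1 ->
  exists d : K, forall e : K, 0 < e -> exists2 r : K, 0 < r &
    forall w : K, `|w - z| < r -> `|f w - (f z + d * (w - z))| <= e * `|w - z|.
Proof.
move=> df; exists ('D_1 f z) => e e0.
move: df; rewrite /derivable => /cvgrPdist_le /(_ _ e0).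
rewrite -/(derive f z 1) => /nbhs_ballP[r /= r0 H]; exists r => // w wz.
have [->|nwz] := eqVneq w z; first by rewrite subrr mulr0 addr0 subrr normr0 mulr0.
have h0 : w - z != 0 by rewrite subr_eq0.
have := H (w - z); rewrite /ball /= sub0r normrN => /(_ wz h0).
rewrite /derive.
set d := lim _.
have -> : (w - z)%:A + z = w :> K^o by rewrite scaler1 subrK.
move=> /(ler_wpM2r (normr_ge0 (w - z))); rewrite -normrM => le.
apply: le_trans le; rewrite distrC mulrBl.
rewrite [_^-1 *: _ * _]mulrAC mulVf // mul1r.
by rewrite [X in _ <= `|X|](_ : _ = f z + d * (w - z) - f w) //; ring.
Qed.

Section Quadrilaterals.
Variable R : realType.
Local Notation C := R[i].

Lemma posC (e : C) : 0 < e -> exists2 r : R, 0 < r & e = r%:C.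
Proof. by case: e => x y; rewrite ltcE /= => /andP[/eqP -> x0]; exists x. Qed.

Lemma dyadic_small (l r : R) : 0 < r -> exists n, l / 2%:R ^+ n < r.
Proof.
move=> r0; have [n nP] : exists n, l / r < n%:R.
  have [|l0] := ltP l 0; first by exists 0%N; rewrite pmulr_llt0 ?invr_gt0.
  by exists (Num.truncn (l / r)).+1; rewrite truncnS_gt.
exists n; rewrite ltr_pdivrMr ?exprn_gt0 // mulrC -ltr_pdivrMr //.
by apply: lt_le_trans nP _; rewrite -natrX ler_nat ltnW // ltn_expl.
Qed.

Definition quad := (C * C * C * C)%type.

(** The half-plane keeps the cells of a bisection, and the points where they
    accumulate, away from 0; it contains the midpoints of its points. *)
Definition quad_in (rho l : R) (q : quad) : Prop := let: (a, b, c, d) := q in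
  [/\ rho <= complex.Re a, rho <= complex.Re b, rho <= complex.Re c & rho <= complex.Re d] /\
  [/\ `|b - a| <= l%:C, `|c - b| <= l%:C, `|d - c| <= l%:C & `|a - d| <= l%:C].

Definition quad_split (q : quad) : quad * quad * quad * quad :=
  let: (a, b, c, d) := q in
  let o := (a + b + c + d) / 4%:R in
  ((a, midpoint a b, o, midpoint d a), (midpoint a b, b, midpoint b c, o),
   (o, midpoint b c, c, midpoint c d), (midpoint d a, o, midpoint c d, d)).

Lemma midpoint_Re (rho : R) (a b : C) :
  rho <= complex.Re a -> rho <= complex.Re b -> rho <= complex.Re (midpoint a b).
Proof.
rewrite /midpoint (_ : (a + b) / 2%:R = (2%:R^-1 : R)%:C * (a + b)); last first.
  by rewrite rmorphV ?unitfE // rmorph_nat mulrC.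
case: a b => [a1 a2] [b1 b2] /=; rewrite mul0r subr0 => ha hb; lra.
Qed.

Lemma quad_split_in (rho l : R) (q : quad) : quad_in rho (2%:R * l) q ->
  let: (q1, q2, q3, q4) := quad_split q in
  [/\ quad_in rho l q1, quad_in rho l q2, quad_in rho l q3 & quad_in rho l q4].
Proof.
case: q => [[[a b] c] d] [[ra rb rc rd] [ab bc cd da]] /=.
have Er : rho <= complex.Re ((a + b + c + d) / 4%:R).
  have -> : (a + b + c + d) / 4%:R = midpoint (midpoint a b) (midpoint c d).
    by rewrite /midpoint; field.
  by do 3 ?apply: midpoint_Re.
have side (x y : C) : `|x| <= (2%:R * l)%:C -> `|y| <= (2%:R * l)%:C ->
    `|(x + y) / 4%:R| <= l%:C.
  rewrite normrM normfV normr_nat ler_pdivrMr ?ltr0n // rmorphM rmorph_nat => x1 y1.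
  apply: le_trans (ler_normD _ _) _; apply: le_trans (lerD x1 y1) _.
  by rewrite le_eqVlt; apply/orP; left; apply/eqP; ring.
have opp (x : C) : `|x| <= (2%:R * l)%:C -> `|- x| <= (2%:R * l)%:C by rewrite normrN.
split; (split; first by split=> //; apply: midpoint_Re);
 split;
 (* a side of a small quadrilateral is half a side of the large one, or the
    half-sum of two opposite sides, halved *)
 match goal with |- is_true (`|?x - ?y| <= _) => first
 [ rewrite (_ : x - y = ((b - a) + (b - a)) / 4%:R) ; [by apply: side|by rewrite /midpoint; field]
 | rewrite (_ : x - y = ((c - b) + (c - b)) / 4%:R) ; [by apply: side|by rewrite /midpoint; field]
 | rewrite (_ : x - y = ((d - c) + (d - c)) / 4%:R) ; [by apply: side|by rewrite /midpoint; field]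
 | rewrite (_ : x - y = ((a - d) + (a - d)) / 4%:R) ; [by apply: side|by rewrite /midpoint; field]
 | rewrite (_ : x - y = (- (a - d) + (c - b)) / 4%:R) ; [by apply: side => //; apply:
     opp|by rewrite /midpoint; field]
 | rewrite (_ : x - y = (- (c - b) + (a - d)) / 4%:R) ; [by apply: side => //; apply:
     opp|by rewrite /midpoint; field]
 | rewrite (_ : x - y = (- (b - a) + (d - c)) / 4%:R) ; [by apply: side => //; apply:
     opp|by rewrite /midpoint; field]
 | rewrite (_ : x - y = (- (d - c) + (b - a)) / 4%:R) ; [by apply: side => //; apply:
     opp|by rewrite /midpoint; field] ] end.
Qed.
End Quadrilaterals.

Section Goursat.
Variable R : realType.
Local Notation C := R[i].

Lemma real_normC (z : C) : `|z| = (complex.Re `|z|)%:C.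
Proof. by rewrite normc_def. Qed.

Definition quad_contour m (f : C -> C) (q : quad R) := let: (a, b, c, d) := q in contour m
    f a b c d.

Lemma quad_contour_split m f (q : quad R) :
  let: (q1, q2, q3, q4) := quad_split q in
  quad_contour m.+1 f q = quad_contour m f q1 + quad_contour m f q2
    + quad_contour m f q3 + quad_contour m f q4.
Proof. by case: q => [[[a b] c] d] /=; apply: contour_split. Qed.

(** A quadrilateral for which the sums stay large has a quarter for which they
    stay large in proportion to its area; at the point where these quarters
    accumulate the affine approximation of [f] contradicts this. *)
Lemma goursat (f : C -> C) (rho l e : R) (q0 : quad R) :
  0 < rho -> 0 < e ->
  (forall z, 0 < complex.Re z -> derivable (f : C^o -> C^o) z 1) ->
  quad_in rho l q0 ->
  exists M, forall m, (M <= m)%N -> `|quad_contour m f q0| <= e%:C.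
Proof.
move=> rho0 e0 df q0in.
have l0 : 0 <= l.
  by case: (q0) q0in => [[[a b] c] d] /= [_ [ab _ _ _]]; rewrite -lecR; exact: le_trans
      (normr_ge0 _) ab.
have h : 0 < 24%:R * l ^+ 2 + 1 by rewrite ltr_wpDl // mulr_ge0 // sqr_ge0.
(* the corners of a cell are at distance at most 6 l from the limit point, for
   sides of length l, so an approximation within eps / 6 bounds the sum over
   the four sides by 4 eps l ^ 2, well below 24 eps l ^ 2 *)
pose eps := e / (24%:R * l ^+ 2 + 1).
have eps0 : 0 < eps by rewrite divr_gt0.
pose L n := l / 2%:R ^+ n.
pose bnd n : C := (24%:R * (eps * L n ^+ 2))%:C.
pose good n q := exists M, forall m, (M <= m)%N -> `|quad_contour m f q| <= bnd n.
suff [M MP] : good 0%N q0.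
  exists M => m /MP H; apply: le_trans H _.
  rewrite lecR /L expr0 divr1 /eps.
  rewrite mulrCA -mulrA ger_pMr // mulrC ler_pdivrMr // mul1r; lra.
apply: contrapT => nM.
pose bad n q := quad_in rho (L n) q /\ ~ good n q.
have half n : L n = 2%:R * L n.+1.
  by rewrite /L exprS; field; rewrite expf_neq0.
have [] := @bisection R (quad R) bad (fun q => q.1.1.1) (2%:R * l) q0.
- move=> n q [qin nog].
  have := qin; rewrite half => /quad_split_in.
  have qS m := quad_contour_split m f q.
  have first_close : let: (q1, q2, q3, q4) := quad_split q in
     [/\ `|q1.1.1.1 - q.1.1.1| <= (2%:R * L n.+1)%:C, `|q2.1.1.1 - q.1.1.1| <= (2%:R * L n.+1)%:C,
         `|q3.1.1.1 - q.1.1.1| <= (2%:R * L n.+1)%:C & `|q4.1.1.1 - q.1.1.1| <= (2%:R * L n.+1)%:C].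
    rewrite -half; case: (q) qin => [[[a b] c] d] /= [_ [ab bc cd da]] /=.
    have Ln0 : 0 <= (L n)%:C by apply: le_trans ab.
    have E x y : `|x| <= (L n)%:C -> `|y| <= (L n)%:C -> `|(x + y) / 2%:R| <= (L n)%:C.
      move=> x1 y1; rewrite normrM normfV normr_nat ler_pdivrMr ?ltr0n //.
      by rewrite mulr_natr mulr2n (le_trans (ler_normD _ _)) // lerD.
    split; first by rewrite subrr normr0.
    + rewrite (_ : _ - a = (b - a + 0) / 2%:R); last by rewrite /midpoint; field.
      by apply: E; rewrite ?normr0.
    + rewrite (_ : _ - a = ((b - a + (b - a)) / 2%:R + ((c - b) - (a - d)) / 2%:R) / 2%:R).
        by apply: (E _ _); apply: (E _ _); rewrite ?normrN.
      by field.
    + rewrite (_ : _ - a = (- (a - d) + 0) / 2%:R); last by rewrite /midpoint; field.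
      by apply: E; rewrite ?normr0 ?normrN.
  have LE : 2%:R * l / 2%:R ^+ n.+1 = 2%:R * L n.+1 by rewrite /L mulrA.
  rewrite LE; case: (quad_split q) qS first_close => [[[q1 q2] q3] q4] qS [c1 c2 c3 c4] [i1
      i2 i3 i4].
  have [[M1 G1]|n1] := pselect (good n.+1 q1); last by exists q1.
  have [[M2 G2]|n2] := pselect (good n.+1 q2); last by exists q2.
  have [[M3 G3]|n3] := pselect (good n.+1 q3); last by exists q3.
  have [[M4 G4]|n4] := pselect (good n.+1 q4); last by exists q4.
  case: nog; exists (maxn (maxn M1 M2) (maxn M3 M4)).+1 => -[//|m].
  rewrite ltnS !geq_max qS => /andP[/andP[m1 m2] /andP[m3 m4]].
  have -> : bnd n = bnd n.+1 + bnd n.+1 + bnd n.+1 + bnd n.+1.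
    by rewrite /bnd -!rmorphD half /=; congr (_%:C); ring.
  do 3 ?[apply: le_trans (ler_normD _ _) _; apply: lerD].
  + exact: G1.
  + exact: G2.
  + exact: G3.
  + exact: G4.
- by split=> //; rewrite /L expr0 divr1.
move=> z zP.
have zRe : 0 < complex.Re z.
  have [n nP] := dyadic_small (4%:R * l) rho0.
  have [[[[a b] c] d] [[[ra _ _ _] _] _] /normc_Re_le] := zP n.
  rewrite raddfB /= ler_norml => /andP[z1 _].
  have : 2%:R * (2%:R * l / 2%:R ^+ n) = 4%:R * l / 2%:R ^+ n by rewrite !mulrA -natrM.
  lra.
have [v vP] := derivable_affine_approx (df z zRe).
have epsC : 0 < (eps / 6%:R)%:C :> C by rewrite ltcR divr_gt0.
have [_ /posC[r r0 ->] near_z] := vP _ epsC.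
have [n nr] := dyadic_small (6%:R * l) r0.
have [[[[a b] c] d] [[_ [ab bc cd da]] nog] za] := zP n.
have {}nr : 6%:R * L n < r by rewrite /L mulrA.
rewrite /= -mulrA -/(L n) in za ab bc cd da.
apply: nog; exists 0%N => m _ /=.
have Ln0 : 0 <= L n by rewrite divr_ge0 // exprn_ge0.
pose D w := `|w - z| <= (6%:R * L n)%:C.
have Dab x y k : `|x - z| <= (k * L n)%:C -> `|y - x| <= (L n)%:C -> `|y - z| <= ((k + 1) * L n)%:C.
  move=> xz yx; rewrite (_ : y - z = (x - z) + (y - x)); last by ring.
  rewrite mulrDl mul1r rmorphD.
  by apply: le_trans (ler_normD _ _) _; apply: lerD.
have Da : `|a - z| <= (4%:R * L n)%:C.
  by rewrite distrC; apply: le_trans za _; rewrite lecR; lra.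
have Db := Dab _ _ _ Da ab.
have Dc := Dab _ _ _ Db bc.
rewrite distrC in da; have Dd := Dab _ _ _ Da da.
have D6 w k : k <= 6%:R -> `|w - z| <= (k * L n)%:C -> D w.
  by move=> k6 H; apply: le_trans H _; rewrite lecR ler_wpM2r.
have H : `|contour m f a b c d| <= 4%:R * ((eps * L n)%:C * (L n)%:C).
  apply: (@contour_affine_close _ m f (f z - v * z) v D).
  - move=> x y Dx Dy; rewrite /D.
    rewrite (_ : midpoint x y - z = ((x - z) + (y - z)) / 2%:R); last by rewrite /midpoint; field.
    rewrite normrM normfV normr_nat ler_pdivrMr ?ltr0n // mulr_natr mulr2n.
    by rewrite (le_trans (ler_normD _ _)) // lerD.
  - move=> x Dx; rewrite (_ : f z - v * z + v * x = f z + v * (x - z)); last by ring.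
    apply: le_trans (near_z _ _) _; first by apply: le_lt_trans Dx _; rewrite ltcR.
    have -> : eps * L n = eps / 6%:R * (6%:R * L n) by field.
    by rewrite [leRHS]rmorphM ler_wpM2l // ltW.
  - by apply: D6 Da; rewrite ?natr1 ler_nat.
  - by apply: D6 Db; rewrite ?natr1 ler_nat.
  - by apply: D6 Dc; rewrite ?natr1 ler_nat.
  - by apply: D6 Dd; rewrite ?natr1 ler_nat.
  - by rewrite (distrC a).
apply: le_trans H _; rewrite /bnd -rmorphM -(rmorph_nat (real_complex R)) -rmorphM lecR.
rewrite expr2 (mulrA eps) ler_wpM2r ?ler_nat //.
exact: mulr_ge0 (mulr_ge0 (ltW eps0) Ln0) Ln0.
Qed.
End Goursat.

(** * The theorem of Liouville and sections of O(1) *)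

Section RotationInvariant.
Variable R : realType.
Local Notation C := R[i].
Local Notation ic := ('i%C : C).

(** On the segment from 1 - i to 1 + i the real part of 1 / z is at least 1/2;
    this keeps the sums for 1 / z away from 0 at every level [m]. *)
Lemma Im_trapezoid_inv m (s t : R) : -1 <= s -> s <= t -> t <= 1 ->
  (t - s) / 2%:R <= complex.Im (trapezoid m (fun z : C => z^-1) (1 +i* s) (1 +i* t)).
Proof.
have e2 : 2%:R = (2%:R : R)%:C :> C by rewrite rmorph_nat.
have T0 f (a b : C) : trapezoid 0 f a b = (f a + f b) / 2%:R * (b - a) by [].
have TS n f (a b : C) : trapezoid n.+1 f a b =
  trapezoid n f a (midpoint a b) + trapezoid n f (midpoint a b) b by [].
elim: m s t => [|m IH] s t s1 st t1; rewrite ?T0 ?TS.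
  have Re_inv (y : R) : -1 <= y -> y <= 1 -> 1 / 2%:R <= 1 / (1 ^+ 2 + y ^+ 2).
    move=> y1 y2; have y21 : y ^+ 2 <= 1 by nra.
    have y20 : 0 <= y ^+ 2 by apply: sqr_ge0.
    rewrite !div1r lef_pV2 ?posrE; lra.
  have := Re_inv s s1 (le_trans st t1); have := Re_inv t (le_trans s1 st) t1.
  set u := 1 / (1 ^+ 2 + s ^+ 2); set v := 1 / (1 ^+ 2 + t ^+ 2) => hv hu.
  rewrite (_ : (_ + _) / 2%:R = (u + v) / 2%:R +i* ((- s / (1 ^+ 2 + s ^+ 2) - t / (1 ^+ 2
      + t ^+ 2)) / 2%:R)); last first.
    have inv (y : R) : (1 +i* y)^-1 = (1 / (1 ^+ 2 + y ^+ 2)) -i* (y / (1 ^+ 2 + y ^+ 2)) by [].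
    rewrite !inv e2 -fmorphV.
    by apply/eqP; rewrite eq_complex /= -/u -/v; apply/andP; split; apply/eqP; ring.
  rewrite /= subrr mulr0 addr0; nra.
have -> : midpoint (1 +i* s) (1 +i* t) = 1 +i* ((s + t) / 2%:R) :> C.
  rewrite /midpoint e2 -fmorphV.
  by apply/eqP; rewrite eq_complex /=; apply/andP; split; apply/eqP; field.
rewrite raddfD /=.
have h1 := IH s ((s + t) / 2%:R); have h2 := IH ((s + t) / 2%:R) t.
have {}h1 := h1 s1 ltac:(lra) ltac:(lra).
have {}h2 := h2 ltac:(lra) ltac:(lra) t1.
lra.
Qed.

(** The function N(z) / z is differentiable in the half-plane Re z > 0. The
    trapezoid with corners r(1 - i), p(1 - i), p(1 + i), r(1 + i) has two slanted
    sides, over which the sums cancel because the rotation by i fixes [N]. So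
    the sums over the two vertical sides are nearly equal; for small [r] and
    large [p] they are nearly N(0) and [g] times one and the same number, the
    sum for 1 / z, which is not small. *)
Lemma entire_rotation_invariant (N : C -> C) (g : C) :
  (forall z, derivable (N : C^o -> C^o) z 1) ->
  (forall z, N (ic * z) = N z) ->
  (forall e : R, 0 < e -> exists K : R, forall z, K%:C <= `|z| -> `|N z - g| <= e%:C) ->
  N 0 = g.
Proof.
move=> dN Ni Nlim.
pose a : C := 1 +i* (-1); pose b : C := 1 +i* 1.
have ab : b = ic * a by rewrite /a /b; apply/eqP; rewrite eq_complex /=; apply/andP; split;
    apply/eqP; ring.
pose H z := N z / z.
have dH z : 0 < complex.Re z -> derivable (H : C^o -> C^o) z 1.
  move=> z0; apply: derivableM => //; apply: derivableV => //.
  by apply: contraTneq z0 => ->; rewrite ltxx.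
have iHi z : ic * H (ic * z) = H z.
  have i0 : ic != 0 by rewrite eq_complex /= oner_eq0 andbF.
  by rewrite /H Ni invfM mulrCA (mulrA ic) mulfV // mul1r.
pose k m := trapezoid m (fun z : C => z^-1) a b.
have k1 m : 1 <= `|k m|.
  have h : (1 - -1) / 2%:R <= complex.Im (k m) by apply: Im_trapezoid_inv => //; lra.
  have : 1 <= complex.Im (k m) by lra.
  case: (k m) => x y /= y1; rewrite normc_def /= lecR -[leLHS]sqrtr1 ler_wsqrtr //.
  nra.
have kr m (r : R) : 0 < r -> trapezoid m (fun z : C => z^-1) (r%:C * a) (r%:C * b) = k m.
  move=> r0; rewrite trapezoid_scale; congr trapezoid; apply/funext => z.
  by rewrite invfM mulVKf // gt_eqF // ltcR.
have Re_a (q : R) : complex.Re (q%:C * a) = q by rewrite /=; ring.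
have Re_b (q : R) : complex.Re (q%:C * b) = q by rewrite /=; ring.
have norm_a1 : `|a| <= (2%:R)%:C.
  by apply: le_trans (normc_le_ReIm _ _) _; rewrite normrN normr1 lecR.
have norm_b1 : `|b| <= (2%:R)%:C.
  by apply: le_trans (normc_le_ReIm _ _) _; rewrite normr1 lecR.
have norm_q (q : R) (x : C) : 0 <= q -> `|x| <= (2%:R)%:C -> `|q%:C * x| <= (2%:R * q)%:C.
  move=> q0 x2; rewrite normrM ger0_norm ?lecR // mulrC (rmorphM (real_complex R)) /=.
  by rewrite ler_wpM2r // lecR.
have norm_a q : 0 <= q -> `|q%:C * a| <= (2%:R * q)%:C by move=> /norm_q; apply.
have norm_b q : 0 <= q -> `|q%:C * b| <= (2%:R * q)%:C by move=> /norm_q; apply.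
have ab_norm : `|b - a| = (2%:R)%:C.
  rewrite (_ : b - a = (2%:R : R)%:C * 'i%C).
    by rewrite normrM normCi mulr1 ger0_norm // lecR.
  by apply/eqP; rewrite eq_complex /=; apply/andP; split; apply/eqP; ring.
have edge m (r e : R) (u : C) : 0 < r -> 0 <= e ->
   (forall z, r%:C <= `|z| -> `|z| <= (2%:R * r)%:C -> `|N z - u| <= e%:C) ->
   `|trapezoid m H (r%:C * a) (r%:C * b) - u * k m| <= (2%:R * e)%:C.
  move=> r0 e0 Nu.
  pose D (z : C) := r <= complex.Re z /\ `|z| <= (2%:R * r)%:C.
  rewrite -(kr m r r0) -trapezoidZ.
  have -> : (2%:R * e)%:C = (e / r)%:C * `|r%:C * b - r%:C * a|.
    rewrite -mulrBr normrM ab_norm ger0_norm ?lecR; last exact: ltW.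
    by rewrite -!rmorphM; congr (_%:C); field; rewrite gt_eqF.
  apply: (trapezoid_close m (D := D)).
  - move=> x y [x1 x2] [y1 y2]; split; first exact: midpoint_Re.
    rewrite /midpoint normrM normfV normr_nat ler_pdivrMr ?ltr0n // mulr_natr mulr2n.
    by rewrite (le_trans (ler_normD _ _)) // lerD.
  - move=> z [z1 z2].
    have rz : r%:C <= `|z|.
      apply: contraTT z1 => nrz; rewrite -ltNge.
      move: nrz; rewrite real_normC lecR -ltNge => lt_r.
      by have := normc_Re_le (r := complex.Re `|z|) (z := z); rewrite -real_normC ler_norml
          => /(_ (lexx _))/andP[_ h]; lra.
    rewrite /H -mulrBl normrM normfV ler_pdivrMr ?(lt_le_trans _ rz) ?ltcR //.
    apply: le_trans (Nu z rz z2) _.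
    rewrite (_ : e = e / r * r); last by field; rewrite gt_eqF.
    by rewrite [leLHS]rmorphM mulfK ?gt_eqF // ler_wpM2l // lecR divr_ge0 // ltW.
  - by split; [rewrite Re_a | apply: norm_a; apply: ltW].
  - by split; [rewrite Re_b | apply: norm_b; apply: ltW].
suff small (e : R) : 0 < e -> `|g - N 0| <= (5%:R * e)%:C.
  apply/eqP; rewrite eq_sym -subr_eq0 -normr_eq0 real_normC.
  set x := complex.Re _; have [->//|x0] := eqVneq x 0.
  have x_gt0 : 0 < x by rewrite lt0r x0 -lecR -real_normC normr_ge0.
  have := small (x / 10%:R) ltac:(lra).
  by rewrite real_normC -/x lecR; lra.
move=> e0.
have [K KP] := Nlim e e0.
have [r r0 rP] : exists2 r : R, 0 < r & forall z, `|z| <= (2%:R * r)%:C -> `|N z - N 0| <= e%:C.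
  have := dN 0; move/derivable1_diffP/differentiable_continuous.
  have eC : 0 < e%:C :> C by rewrite ltcR.
  move=> /cvgrPdist_le/(_ _ eC)/nbhs_ballP[_ /posC[r r0 ->] near0].
  exists (r / 4%:R); first by lra.
  move=> z zr; rewrite distrC; apply: near0; rewrite /ball /= sub0r normrN.
  by apply: le_lt_trans zr _; rewrite ltcR; lra.
pose p := Num.max r K.
have rp : r <= p by rewrite le_max lexx.
have p0 : 0 < p by apply: lt_le_trans rp.
have [M MP] : exists M, forall m, (M <= m)%N -> `|quad_contour m H (r%:C * a, p%:C * a,
    p%:C * b, r%:C * b)| <= e%:C.
  apply: (@goursat R H r (2%:R * p)) => //; split; first by rewrite !Re_a !Re_b.
  have rp2 (x : C) : `|x| <= (2%:R)%:C -> `|p%:C * x - r%:C * x| <= (2%:R * p)%:C.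
    move=> x2; rewrite -mulrBl -rmorphB normrM ger0_norm ?lecR ?subr_ge0 //.
    apply: le_trans (ler_wpM2l _ x2) _; first by rewrite lecR subr_ge0.
    by rewrite -rmorphM lecR; lra.
  have pq2 (q : R) : 0 < q -> q <= p -> `|q%:C * b - q%:C * a| <= (2%:R * p)%:C.
    move=> q0 qp; have q0' : 0 <= q%:C :> C by rewrite lecR ltW.
    rewrite -mulrBr normrM ab_norm ger0_norm // -(rmorphM (real_complex R)) lecR; lra.
  split; first 1 last.
  - exact: pq2.
  - rewrite distrC; apply: rp2; exact: norm_b1.
  - by rewrite distrC; apply: pq2.
  - by apply: rp2; exact: norm_a1.
have := MP M (leqnn M); rewrite /= /contour.
have -> : trapezoid M H (p%:C * b) (r%:C * b) = - trapezoid M H (r%:C * a) (p%:C * a).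
  rewrite trapezoid_rev ab !(mulrCA _ ic) trapezoid_scale; congr (- trapezoid _ _ _ _).
  exact/funext.
rewrite (trapezoid_rev _ _ (r%:C * a) (r%:C * b)).
have h1 := edge M r e (N 0) r0 (ltW e0) (fun z _ => rP z).
have Kp (z : C) : p%:C <= `|z| -> K%:C <= `|z|.
  by apply: le_trans; rewrite lecR le_max lexx orbT.
have h2 := edge M p e g p0 (ltW e0) (fun z pz _ => KP z (Kp z pz)).
set Tp := trapezoid M H (p%:C * a) _ in h2 *.
set Tr := trapezoid M H (r%:C * a) (r%:C * b) in h1 *.
set U := trapezoid _ _ _ _ => h3.
have k1g : `|g - N 0| <= `|(g - N 0) * k M|.
  by rewrite normrM -[leLHS]mulr1 ler_wpM2l.
apply: le_trans k1g _.
rewrite (_ : (g - N 0) * k M = (U + Tp - U - Tr) + ((Tr - N 0 * k M) - (Tp - g * k M)));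
    last by ring.
rewrite (_ : 5%:R * e = e + (2%:R * e + 2%:R * e)); last by ring.
rewrite !(rmorphD (real_complex R)) /=.
apply: le_trans (ler_normD _ _) _; apply: lerD; first exact: h3.
by apply: le_trans (ler_normB _ _) _; apply: lerD.
Qed.
End RotationInvariant.

(** Turns a map given by a formula into an element of the type of linear maps
    between finite dimensional spaces. *)
Lemma hom_of_linear (K : fieldType) (U W : vectType K) (f : U -> W) :
  linear f -> exists g : 'Hom(U, W), g =1 f.
Proof.
move=> lf.
pose F : {linear U -> W} := HB.pack f (GRing.isLinear.Build K U W *:%R f lf).
by exists (linfun F) => u; rewrite lfunE.
Qed.

Section Liouville.
Variable R : realType.
Local Notation C := R[i].
Local Notation ic := ('i%C : C).

Lemma derivable_comp_affine (f : C -> C) (a u : C) :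
  (forall z, derivable (f : C^o -> C^o) z 1) ->
  forall z, derivable ((fun z => f (a + u * z)) : C^o -> C^o) z 1.
Proof.
move=> df z; apply/derivable1_diffP.
apply: (@differentiable_comp _ C^o C^o C^o (fun z : C^o => a + u * z : C^o) (f : C^o -> C^o)).
  by apply/derivable1_diffP; apply: derivableD => //; apply: derivableM.
exact/derivable1_diffP.
Qed.

(** Averaging over the rotations of order 4 about [a] gives a function that is
    invariant under the rotation by i and has the same limit. *)
Lemma liouville (f : C -> C) (g : C) :
  (forall z, derivable (f : C^o -> C^o) z 1) ->
  (forall e : R, 0 < e -> exists K : R, forall z, K%:C <= `|z| -> `|f z - g| <= e%:C) ->
  forall a, f a = g.
Proof.
move=> df flim a.
pose N z := f (a + 1 * z) + f (a + ic * z) + f (a + -1 * z) + f (a + - ic * z).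
have ii : ic * ic = -1 by rewrite -expr2 sqr_i.
suff : N 0 = 4%:R * g.
  rewrite /N !mulr0 !addr0 (_ : _ + _ = 4%:R * f a); last by ring.
  by apply: mulfI; rewrite pnatr_eq0.
apply: entire_rotation_invariant.
- move=> z; have d u := @derivable_comp_affine f a u df z.
  exact: derivableD (derivableD (derivableD (d _) (d _)) (d _)) (d _).
- move=> z; rewrite /N.
  have -> : 1 * (ic * z) = ic * z by rewrite mul1r.
  have -> : ic * (ic * z) = -1 * z by rewrite mulrA ii.
  have -> : -1 * (ic * z) = - ic * z by rewrite mulN1r mulNr.
  have -> : - ic * (ic * z) = 1 * z by rewrite mulrA mulNr ii opprK.
  by ring.
move=> e e0; have [|K KP] := flim (e / 4%:R); first by lra.
exists (K + complex.Re `|a|) => z zK.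
have fz u : `|u| = 1 -> `|f (a + u * z) - g| <= (e / 4%:R)%:C.
  move=> u1; apply: KP.
  have az : `|z| <= `|a + u * z| + `|a|.
    rewrite -[`|z|]mul1r -u1 -normrM [X in `|X|](_ : _ = (a + u * z) - a); last by ring.
    exact: ler_normB.
  move: zK; rewrite rmorphD /= -real_normC => zK.
  by rewrite -(lerD2r `|a|); apply: le_trans zK az.
rewrite (_ : _ - _ = (f (a + 1 * z) - g) + (f (a + ic * z) - g) + (f (a + -1 * z) - g) + (f
    (a + - ic * z) - g)); last by rewrite /N; ring.
rewrite (_ : e = e / 4%:R + e / 4%:R + e / 4%:R + e / 4%:R); last by field.
rewrite !(rmorphD (real_complex R)) /=.
do 3 ?[apply: le_trans (ler_normD _ _) _; apply: lerD]; apply: fz;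
  by rewrite ?normrN ?normCi ?normr1.
Qed.

(** The function h(z) - k(0) z tends to k'(0) at infinity. *)
Lemma section_O1_affine (h k : C -> C) :
  (forall z, derivable (h : C^o -> C^o) z 1) ->
  derivable (k : C^o -> C^o) 0 1 ->
  (forall z, z != 0 -> h z = z * k z^-1) ->
  forall z, h z = h 0 + z * k 0.
Proof.
move=> dh dk hk.
have [d dP] := derivable_affine_approx dk.
(* the slope d of k at 0 is the limit of h(z) - k(0) z at infinity *)
pose p (z : C^o) : C^o := - k 0 * z.
have dp (z : C^o) : derivable p z (1 : C^o).
  exact: (@derivableM _ C^o (fun _ => - k 0) (fun x => x) z 1 (derivable_cst _ _ _)
      (@derivable_id _ C^o z 1)).
have q_cst a : h a + - k 0 * a = d.
  apply: (@liouville (fun z => h z + - k 0 * z)).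
    by move=> z; exact: (@derivableD _ C^o C^o h p z 1 (dh z) (dp z)).
  move=> e e0; have eC : 0 < e%:C :> C by rewrite ltcR.
  have [_ /posC[r r0 ->] rP] := dP _ eC.
  exists (2%:R / r) => z zr.
  have z0 : z != 0.
    by rewrite -normr_gt0; apply: lt_le_trans zr; rewrite ltcR divr_gt0.
  rewrite hk // (_ : _ - d = z * (k z^-1 - (k 0 + d * (z^-1 - 0)))); last by field.
  rewrite normrM.
  have lt : `|z^-1 - 0| < r%:C.
    rewrite subr0 normfV invf_plt ?posrE ?normr_gt0 ?ltcR //.
    rewrite -fmorphV; apply: lt_le_trans zr; by rewrite ltcR ltr_pMl ?invr_gt0 ?ltr1n.
  apply: le_trans (ler_wpM2l (normr_ge0 _) (rP _ lt)) _.
  by rewrite subr0 normfV mulrCA mulfV ?mulr1 // normr_eq0.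
have h0 : h 0 = d by rewrite -(q_cst 0) mulr0 addr0.
move=> z; rewrite h0 -(q_cst z); ring.
Qed.

Lemma section_O1_affine_vect (W : vectType C) (f0 f1 : C -> W) :
  holomorphic f0 -> holomorphic f1 ->
  (forall z, z != 0 -> f0 z = z *: f1 z^-1) ->
  forall z, f0 z = f0 0 + z *: f1 0.
Proof.
move=> hf0 hf1 f01.
have dh (f : C -> W) (hf : holomorphic f) (l : 'Hom(W, C^o)) z :
    derivable ((fun t => l (f t)) : C^o -> C^o) z 1.
  exact: (nbhs_singleton (hf z)).
have sep (u v : W) : (forall l : 'Hom(W, C^o), l u = l v) -> u = v.
  move=> uv; rewrite (coord_vbasis (memvf u)) (coord_vbasis (memvf v)).
  apply: eq_bigr => i _; congr (_ *: _).
  have [l lE] : exists l : 'Hom(W, C^o), l =1 coord (vbasis fullv) i.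
    by apply: hom_of_linear => a x y; rewrite linearP.
  by rewrite -!lE uv.
move=> z; apply: sep => l; rewrite linearD linearZ /=.
apply: (section_O1_affine (h := fun z => l (f0 z)) (k := fun z => l (f1 z))).
- exact: dh.
- exact: dh.
- by move=> t t0; rewrite f01 // linearZ.
Qed.
End Liouville.

(** * Pencils of subspaces *)

Lemma eq_range (X Y : Type) (f g : X -> Y) : f =1 g -> range f = range g.
Proof. by move=> fg; rewrite (funext fg). Qed.

Section Frames.
Variable R : realType.
Local Notation C := R[i].

(** An eigenvector inside an invariant subspace, without restricting the matrix
    to it: by Cayley-Hamilton the product of the factors [M - c] over the roots
    of the characteristic polynomial kills [x], and the last nonzero vector
    obtained by applying the factors in turn is an eigenvector. *)
Lemma eigenvector_in (F : closedFieldType) n (M : 'M[F]_n) (N : 'rV[F]_n -> Prop) (x : 'rV[F]_n) :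
  (forall y c, N y -> N (y *m M - c *: y)) -> N x -> x != 0 ->
  exists c y, [/\ N y, y != 0 & y *m M = c *: y].
Proof.
case: n => [|n] in M N x *; first by rewrite (thinmx0 x) eqxx.
move=> Nstable.
have [r rP] := closed_field_poly_normal (char_poly M).
have : x *m \prod_(c <- r) (M - c%:M) = 0.
  have := Cayley_Hamilton M; rewrite rP (monicP (char_poly_monic M)) scale1r rmorph_prod /=.
  under eq_bigr do rewrite rmorphB /= horner_mx_X horner_mx_C.
  by move=> ->; rewrite mulmx0.
elim: r x {rP} => [|c r IH] x; first by rewrite big_nil mulmx1 => -> _ /eqP.
rewrite big_cons mulmxA => xr Nx x0.
have [xc|xc] := eqVneq (x *m (M - c%:M)) 0.
  exists c, x; split=> //; apply/eqP; rewrite -subr_eq0.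
  by rewrite -mul_mx_scalar -mulmxBr xc.
by apply: IH xr _ xc; rewrite mulmxBr mul_mx_scalar; apply: Nstable.
Qed.

Variables (W : vectType C) (n : nat).
Local Notation Cn := 'rV[C]_n.

(** An isomorphism of [W] with C^2 (x) C^n: [A] and [B] are the inclusions of
    the two copies of C^n, and [A'] and [B'] the coordinates. *)
Record frame (A B : 'Hom(Cn, W)) (A' B' : 'Hom(W, Cn)) : Prop := Frame {
  frame_AA : forall x, A' (A x) = x;
  frame_AB : forall x, A' (B x) = 0;
  frame_BA : forall x, B' (A x) = 0;
  frame_BB : forall x, B' (B x) = x;
  frame_sum : forall w, A (A' w) + B (B' w) = w }.

(** Under the isomorphism given by a frame, the fibre over z is the line
    spanned by (1, z), tensored with C^n. *)
Definition pencil (A B : 'Hom(Cn, W)) (p : P1 R) : set W :=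
  if p is Some z then range (fun x => A x + z *: B x) else range B.

(** The quotient maps P + z Q turn the injectivity of the pencil at each point
    into a decomposition of [W]; the coordinates [B'] and [A'] are D^-1 P and
    - D^-1 Q for D = PB = - QA. *)
Lemma frame_of_pencil (A B : 'Hom(Cn, W)) (P Q : 'Hom(W, Cn)) :
  (forall z, injective (fun x => A x + z *: B x)) -> injective B ->
  (forall z, [set w | P w + z *: Q w = 0] = range (fun x => A x + z *: B x)) ->
  [set w | Q w = 0] = range B ->
  exists A' B', frame A B A' B'.
Proof.
move=> ABinj Binj PQ QB.
have A_inj : injective A.
  by move=> x y xy; apply: (ABinj 0); rewrite !scale0r !addr0.
have kerP w : P w = 0 -> exists x, w = A x.
  move=> Pw; have : [set w | P w + 0 *: Q w = 0] w by rewrite /= scale0r addr0.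
  by rewrite PQ => -[x _ <-]; exists x; rewrite scale0r addr0.
have PA x : P (A x) = 0.
  have : range (fun x => A x + 0 *: B x) (A x) by exists x => //; rewrite scale0r addr0.
  by rewrite -PQ /= scale0r addr0.
have QBx x : Q (B x) = 0.
  have : range B (B x) by exists x.
  by rewrite -QB.
have QA x : Q (A x) = - P (B x).
  have : range (fun x => A x + 1 *: B x) (A x + 1 *: B x) by exists x.
  rewrite -PQ /= !scale1r !linearD /= PA QBx add0r addr0 => /eqP.
  by rewrite addrC addr_eq0 => /eqP.
pose D : 'End(Cn) := (P \o B)%VF.
have Dx x : D x = P (B x) by rewrite lfunE.
have kerA : lker A = 0%VS by apply/eqP/lker0P.
(* on the kernel N of D the image of B lies in that of A, and S = A^-1 B maps N
   to itself; an eigenvector y of S for c is killed by A - c^-1 B *)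
have D_ker x : D x = 0 -> x = 0.
  move=> Dx0; apply/eqP; apply: contraT => x0.
  pose S : 'End(Cn) := ((A^-1) \o B)%VF.
  have AS y : D y = 0 -> A (S y) = B y.
    rewrite Dx => /kerP[z By]; rewrite lfunE /= By.
    by rewrite lker0_lfunK // kerA.
  have DS y : D y = 0 -> D (S y) = 0.
    by move=> D0; rewrite Dx -[LHS]opprK -QA AS // QBx oppr0.
  have [y|c [y [Dy y0]]] := @eigenvector_in C n (lin1_mx S) (fun x => D x = 0) x _ Dx0 x0.
    by move=> c Dy; rewrite mul_rV_lin1 linearB linearZ /= DS // Dy scaler0 subr0.
  rewrite mul_rV_lin1 => Sy.
  have By : B y = c *: A y by rewrite -(AS y Dy) Sy linearZ.
  have c0 : c != 0.
    apply: contra_neq y0 => c0; apply: Binj.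
    by rewrite By c0 scale0r linear0.
  case/eqP: y0; apply: (ABinj (- c^-1)).
  by rewrite /= By !linear0 ?scaler0 ?addr0 scalerA mulNr mulVf // scaleN1r subrr.
have D_inj : lker D == 0%VS.
  apply/lker0P => x1 x2 /eqP; rewrite -subr_eq0 -linearB => /eqP/D_ker/eqP.
  by rewrite subr_eq0 => /eqP.
have DK := lker0_lfunK D_inj; have DVK := lker0_lfunVK D_inj.
pose A' : 'Hom(W, Cn) := (- ((D^-1) \o Q))%VF; pose B' : 'Hom(W, Cn) := ((D^-1) \o P)%VF.
have A'E w : A' w = - (D^-1)%VF (Q w) by rewrite opp_lfunE lfunE.
have B'E w : B' w = (D^-1)%VF (P w) by rewrite lfunE.
exists A', B'; split=> [x|x|x|x|w].
- by rewrite A'E QA linearN /= opprK -Dx DK.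
- by rewrite A'E QBx linear0 oppr0.
- by rewrite B'E PA linear0.
- by rewrite B'E -Dx DK.
apply/eqP; rewrite -subr_eq0; apply/eqP.
set w' := _ - w.
have Pw' : P w' = 0.
  by rewrite /w' linearB linearD /= PA add0r B'E -Dx DVK subrr.
have Qw' : Q w' = 0.
  by rewrite /w' linearB linearD /= QBx addr0 QA A'E -Dx linearN /= DVK opprK subrr.
have [y w'y] := kerP _ Pw'; rewrite w'y in Qw' *.
rewrite (D_ker y) ?linear0 //; apply/eqP.
by rewrite Dx -oppr_eq0 -QA Qw'.
Qed.

Lemma frame_swap A B A' B' : frame A B A' B' -> frame B A B' A'.
Proof. by case=> h1 h2 h3 h4 h5; split=> // w; rewrite addrC. Qed.

(** Over the chart at infinity [A] and [B] exchange their roles, so that every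
    statement about this chart follows from [frame_swap]. *)
Lemma pencil_chart1 A B w :
  pencil A B (chart1 w) = range (fun x => B x + w *: A x).
Proof.
rewrite /chart1; case: eqVneq => [->|w0] /=.
  by apply: eq_range => x; rewrite scale0r addr0.
apply/seteqP; split=> _ [x _ <-] /=.
- exists (w^-1 *: x) => //.
  by rewrite !linearZ /= scalerA mulVf // scale1r addrC.
- exists (w *: x) => //.
  by rewrite !linearZ /= scalerA mulfV // scale1r addrC.
Qed.

Lemma holomorphic_affine (X : vectType C) (u v : X) : holomorphic (fun z => u + z *: v).
Proof.
move=> z; rewrite /holomorphic_at; apply: filterE => w l.
have -> : (fun t : C^o => l (u + t *: v)) = (fun t : C^o => l u + t * l v : C^o).
  by apply/funext => t; rewrite linearD linearZ.
apply: derivableD => //.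
Qed.

Section FrameBundles.
Variables (A B : 'Hom(Cn, W)) (A' B' : 'Hom(W, Cn)).
Hypothesis fr : frame A B A' B'.

(** A single chart of the Grassmannian suffices for the whole affine line: the
    fibres are the graphs of the multiples of one linear map. *)
Lemma frame_graph_holomorphic : holomorphic_to_Gr n (fun z => range (fun x => A x + z *: B x)).
Proof.
case: fr => AA AB BA BB sum z0.
have A_inj : lker A == 0%VS by apply/lker0P; apply: can_inj AA.
exists (limg A), (limg B); split.
- apply/vspaceP => w; rewrite memvf.
  by rewrite -[w]sum memv_add // memv_img ?memvf.
- apply/eqP; rewrite -subv0; apply/subvP => w.
  rewrite memv_cap memv0 => /andP[/memv_imgP[x _ ->] /memv_imgP[y _ E]].
  by rewrite -[x]AA E AB linear0.
- by rewrite limg_dim_eq ?(eqP A_inj) ?capv0 // dimvf /dim /= mul1n.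
have [L LE] : exists L : 'Hom(subvs_of (limg A), subvs_of (limg B)),
    forall a, L a = vsproj (limg B) (B (A' (vsval a))).
  apply: hom_of_linear => a x y.
  by rewrite !linearP.
exists (fun z => 0 + z *: L); first exact: holomorphic_affine.
apply: filterE => z; apply/seteqP; split=> [_ [x _ <-]|_ [a _ <-]].
- exists (vsproj (limg A) (A x)) => //.
  rewrite add0r !scale_lfunE linearZ /= LE !vsprojK ?memv_img ?memvf //.
  by rewrite AA.
- rewrite add0r !scale_lfunE linearZ /= LE vsprojK ?memv_img ?memvf //.
  exists (A' (vsval a)) => //; congr (_ + _).
  by have /memv_imgP[x _ ->] := subvsP a; rewrite AA.
Qed.

Lemma frame_sub_iso (E : P1 R -> set W) : E = pencil A B -> iso_from_O (- 1) n E.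
Proof.
case: fr => AA AB BA BB sum ->.
exists (fun z => A + z *: B), (fun w => B + w *: A); split.
- exact: holomorphic_affine.
- exact: holomorphic_affine.
- move=> z z0 v; rewrite opprK expr1z !add_lfunE !scale_lfunE !linearZ /=.
  by rewrite scalerA mulfV // scale1r addrC.
- move=> z; split=> [x y|].
    rewrite !add_lfunE !scale_lfunE => /(congr1 A').
    by rewrite !linearD !linearZ /= !AA !AB !scaler0 !addr0.
  by apply: eq_range => x; rewrite add_lfunE scale_lfunE.
- move=> w; split=> [x y|].
    rewrite !add_lfunE !scale_lfunE => /(congr1 B').
    by rewrite !linearD !linearZ /= !BA !BB !scaler0 !addr0.
  rewrite pencil_chart1.
  by apply: eq_range => x; rewrite add_lfunE scale_lfunE.
Qed.

Lemma pencil_eqP z w : range (fun x => A x + z *: B x) w <-> B' w = z *: A' w.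
Proof.
case: fr => AA AB BA BB sum; split=> [[x _ <-]|E].
  by rewrite !linearD !linearZ /= AA AB BA BB !scaler0 addr0 add0r.
by exists (A' w) => //; rewrite -linearZ -E sum.
Qed.
End FrameBundles.

Lemma frame_quotient_iso (A B : 'Hom(Cn, W)) (A' B' : 'Hom(W, Cn)) (E : P1 R -> set W) :
  frame A B A' B' -> E = pencil A B -> quotient_iso_to_O 1 n E.
Proof.
move=> fr ->; have [AA AB BA BB sum] := fr.
exists (fun z => B' + z *: - A'), (fun w => - A' + w *: B'); split.
- exact: holomorphic_affine.
- exact: holomorphic_affine.
- move=> z z0 u; rewrite !add_lfunE !scale_lfunE !opp_lfunE scalerDr scalerA -/(z^-1).
  by rewrite mulVf // scale1r addrC.
- move=> z; split.
    apply/seteqP; split=> // x _; exists (B x) => //.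
    by rewrite add_lfunE scale_lfunE opp_lfunE AB BB oppr0 scaler0 addr0.
  apply/seteqP; split=> w /=; rewrite add_lfunE scale_lfunE opp_lfunE scalerN.
    by move/eqP; rewrite subr_eq0 => /eqP /(pencil_eqP fr).
  by move=> /(pencil_eqP fr) ->; rewrite subrr.
- move=> w; split.
    apply/seteqP; split=> // x _; exists (- A x) => //.
    by rewrite add_lfunE scale_lfunE opp_lfunE !linearN /= AA BA ?oppr0 scaler0 ?oppr0 addr0 opprK.
  rewrite pencil_chart1.
  apply/seteqP; split=> u /=; rewrite add_lfunE scale_lfunE opp_lfunE addrC.
    by move/eqP; rewrite subr_eq0 => /eqP /esym /(pencil_eqP (frame_swap fr)).
  by move=> /(pencil_eqP (frame_swap fr)) ->; rewrite subrr.
Qed.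

End Frames.

(** * Quaternionic structures on complex vector spaces *)

Section ScalarLemmas.
Variable R : realType.
Local Notation C := R[i].

Lemma scale_ii (W : lmodType C) (w : W) : 'i%C *: ('i%C *: w) = - w.
Proof. by rewrite scalerA -expr2 sqr_i scaleN1r. Qed.

Lemma half_double (W : lmodType C) (w : W) : 2%:R^-1 *: (w + w) = w.
Proof.
by rewrite -mulr2n -(scaler_nat 2 w) scalerA mulVf ?pnatr_eq0 // scale1r.
Qed.
End ScalarLemmas.

Section Sphere.
Variable R : realType.
Local Notation C := R[i].

Lemma sphere_antipode (p : P1 R) :
  sphere (antipode p) = let: (a, b, c) := sphere p in (- a, - b, - c).
Proof.
case: p => [[x y]|] /=; last by rewrite expr0n /= addr0 !mulr0 !mul0r !add0r divr1 !oppr0.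
rewrite /chart1 oppr_eq0 eq_complex /= oppr_eq0.
case: ifP => [/andP[/eqP -> /eqP ->]|/negbT xy] /=.
  by rewrite expr0n /= addr0 !mulr0 !mul0r !add0r divr1 !oppr0 opprK.
have s0 : 0 < x ^+ 2 + y ^+ 2.
  rewrite lt0r addr_ge0 ?sqr_ge0 // andbT; apply: contra xy.
  by rewrite paddr_eq0 ?sqr_ge0 // !sqrf_eq0.
rewrite !opprK sqrrN; set s := x ^+ 2 + y ^+ 2 in s0 *.
have E : (- x / s) ^+ 2 + (- (y / s)) ^+ 2 = s^-1.
  by rewrite mulNr !sqrrN !expr_div_n -mulrDl -/s expr2 invfM mulrA mulfV ?mul1r // gt_eqF.
have s1 : s + 1 != 0 by rewrite gt_eqF // addr_gt0.
have s2 : s != 0 by rewrite gt_eqF.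
have s3 : 1 + s != 0 by rewrite addrC.
rewrite E; clearbody s; congr (_, _, _); field; rewrite ?s1 ?s2 ?s3 //.
Qed.

Lemma sphere_norm (p : P1 R) :
  let: (a, b, c) := sphere p in a ^+ 2 + b ^+ 2 + c ^+ 2 = 1.
Proof.
case: p => [[x y]|] /=; last by rewrite expr0n expr1n !add0r.
have s1 : x ^+ 2 + y ^+ 2 + 1 != 0 by rewrite gt_eqF // ltr_wpDl // addr_ge0 // sqr_ge0.
by field.
Qed.

(** The three identities behind the fact that a + i b and a - i b are the
    off-diagonal entries, and c and - c the diagonal ones, of a matrix with
    eigenvector (1, z). *)
Lemma sphere_affine (z : C) : let: (a, b, c) := sphere (Some z) in
  [/\ a%:C + 'i%C * b%:C = (1 - c%:C) * z, (a%:C - 'i%C * b%:C) * z = 1 + c%:C & 1 - c%:C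
      != 0 :> C].
Proof.
case: z => x y /=.
have s1 : x ^+ 2 + y ^+ 2 + 1 != 0 by rewrite gt_eqF // ltr_wpDl // addr_ge0 // sqr_ge0.
split.
- by apply/eqP; rewrite eq_complex /=; apply/andP; split; apply/eqP; field.
- by apply/eqP; rewrite eq_complex /=; apply/andP; split; apply/eqP; field.
- rewrite eq_complex /= negb_and; apply/orP; left.
  rewrite (_ : _ - _ = 2%:R / (x ^+ 2 + y ^+ 2 + 1)); last by field.
  by rewrite mulf_neq0 ?invr_eq0.
Qed.
End Sphere.

Section ComplexQuaternions.
Variable R : realType.
Local Notation C := R[i].
Variable W : vectType C.

(** A quaternionic structure by complex-linear maps. *)
Record cquat (J1 J2 J3 : 'End(W)) : Prop := Cquat {
  cquat1 : forall w, J1 (J1 w) = - w;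
  cquat2 : forall w, J2 (J2 w) = - w;
  cquat12 : forall w, J1 (J2 w) = J3 w;
  cquat21 : forall w, J2 (J1 w) = - J3 w }.

Definition sphere_comb (J1 J2 J3 : 'End(W)) (p : P1 R) : 'End(W) :=
  let: (a, b, c) := sphere p in a%:C *: J1 + b%:C *: J2 + c%:C *: J3.

Lemma sphere_combE J1 J2 J3 p w : sphere_comb J1 J2 J3 p w =
  let: (a, b, c) := sphere p in a%:C *: J1 w + b%:C *: J2 w + c%:C *: J3 w.
Proof.
rewrite /sphere_comb; case: (sphere p) => [[a b] c].
by rewrite !add_lfunE !scale_lfunE.
Qed.

Definition eigenset (J1 J2 J3 : 'End(W)) (p : P1 R) : set W :=
  [set w | sphere_comb J1 J2 J3 p w = 'i%C *: w].

Lemma eigensetE J1 J2 J3 p w :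
  eigenset J1 J2 J3 p w = (sphere_comb J1 J2 J3 p w = 'i%C *: w).
Proof. by []. Qed.

Variable n : nat.
Local Notation Cn := 'rV[C]_n.

(** The action of the quaternions on C^2 (x) C^n through the matrices
    i (0 1; 1 0), (0 1; -1 0) and i (-1 0; 0 1). *)
Definition frame_quat (A B : 'Hom(Cn, W)) (A' B' : 'Hom(W, Cn)) (J1 J2 J3 : 'End(W)) :=
  forall w, [/\ J1 w = 'i%C *: (B (A' w) + A (B' w)),
    J2 w = A (B' w) - B (A' w) & J3 w = 'i%C *: (B (B' w) - A (A' w))].

Lemma frame_quat_exists (A B : 'Hom(Cn, W)) (A' B' : 'Hom(W, Cn)) :
  exists J1 J2 J3, frame_quat A B A' B' J1 J2 J3.
Proof.
exists ('i%C *: ((B \o A') + (A \o B')))%VF, ((A \o B') - (B \o A'))%VF.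
exists ('i%C *: ((B \o B') - (A \o A')))%VF => w.
by split; rewrite !(scale_lfunE, add_lfunE, opp_lfunE, comp_lfunE).
Qed.

Section FrameQuat.
Variables (A B : 'Hom(Cn, W)) (A' B' : 'Hom(W, Cn)) (J1 J2 J3 : 'End(W)).
Hypothesis fr : frame A B A' B'.
Hypothesis fq : frame_quat A B A' B' J1 J2 J3.

Lemma frame_quat_coord w :
  [/\ A' (J1 w) = 'i%C *: B' w, B' (J1 w) = 'i%C *: A' w,
      A' (J2 w) = B' w, B' (J2 w) = - A' w &
      A' (J3 w) = - ('i%C *: A' w) /\ B' (J3 w) = 'i%C *: B' w].
Proof.
have [AA AB BA BB sum] := fr; have [-> -> ->] := fq w.
by split; last split;
  rewrite ?linearZ /= ?linearB ?linearD /= ?AA ?AB ?BA ?BB ?scaler0 ?add0r ?addr0 ?subr0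
      ?sub0r ?scaler0 ?scalerN ?oppr0 ?addr0.
Qed.

Lemma frame_ext v w : A' v = A' w -> B' v = B' w -> v = w.
Proof. by have [_ _ _ _ sum] := fr => hA hB; rewrite -[v]sum hA hB sum. Qed.

Lemma frame_cquat : cquat J1 J2 J3.
Proof.
have a1 w : A' (J1 w) = 'i%C *: B' w by case: (frame_quat_coord w).
have b1 w : B' (J1 w) = 'i%C *: A' w by case: (frame_quat_coord w).
have a2 w : A' (J2 w) = B' w by case: (frame_quat_coord w).
have b2 w : B' (J2 w) = - A' w by case: (frame_quat_coord w).
have a3 w : A' (J3 w) = - ('i%C *: A' w) by case: (frame_quat_coord w) => _ _ _ _ [].
have b3 w : B' (J3 w) = 'i%C *: B' w by case: (frame_quat_coord w) => _ _ _ _ [].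
split=> w; apply: frame_ext; rewrite ?linearN /=.
- by rewrite a1 b1 scale_ii.
- by rewrite b1 a1 scale_ii.
- by rewrite a2 b2.
- by rewrite b2 a2.
- by rewrite a1 b2 a3 scalerN.
- by rewrite b1 a2 b3.
- by rewrite a2 b1 a3 opprK.
- by rewrite b2 a1 b3.
Qed.

(** One pair of coordinates of the eigenvector equation; the equation for the
    second coordinate already determines y, and implies the first one. *)
Let eigen_coord (a b c z x y : C) :
  a + 'i%C * b = (1 - c) * z -> (a - 'i%C * b) * z = 1 + c -> 1 - c != 0 ->
  (a * ('i%C * x) - b * x + c * ('i%C * y) = 'i%C * y <-> y = z * x) /\
  (y = z * x -> a * ('i%C * y) + b * y - c * ('i%C * x) = 'i%C * x).
Proof.
move=> e1 e2 c1; have i2 : 'i%C * 'i%C = -1 :> C by rewrite -expr2 sqr_i.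
have i0 : 'i%C != 0 :> C by rewrite eq_complex /= oner_eq0 andbF.
have Eb : a * ('i%C * x) - b * x + c * ('i%C * y) = 'i%C * ((a + 'i%C * b) * x + c * y).
  rewrite [RHS](_ : _ = a * ('i%C * x) + ('i%C * 'i%C) * b * x + c * ('i%C * y)); last by ring.
  by rewrite i2 mulN1r mulNr.
have Ea : a * ('i%C * y) + b * y - c * ('i%C * x) = 'i%C * ((a - 'i%C * b) * y - c * x).
  rewrite [RHS](_ : _ = a * ('i%C * y) - ('i%C * 'i%C) * b * y - c * ('i%C * x)); last by ring.
  by rewrite i2 mulN1r mulNr opprK.
rewrite Eb Ea e1; split; [split|] => [/(mulfI i0) h|->|->].
- apply: (mulfI c1); rewrite (_ : (1 - c) * (z * x) = (1 - c) * z * x + c * y - c * y);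
    last by ring.
  by rewrite h; ring.
- by congr (_ * _); ring.
- by congr (_ * _); rewrite mulrA e2; ring.
Qed.

(** On coordinates (x, y) the eigenvector equation at the point z has exactly
    the solutions y = z x, and at infinity exactly the solutions x = 0. *)
Lemma eigenset_pencil : eigenset J1 J2 J3 = pencil A B.
Proof.
have [AA AB BA BB sum] := fr.
have a1 w : A' (J1 w) = 'i%C *: B' w by case: (frame_quat_coord w).
have b1 w : B' (J1 w) = 'i%C *: A' w by case: (frame_quat_coord w).
have a2 w : A' (J2 w) = B' w by case: (frame_quat_coord w).
have b2 w : B' (J2 w) = - A' w by case: (frame_quat_coord w).
have a3 w : A' (J3 w) = - ('i%C *: A' w) by case: (frame_quat_coord w) => _ _ _ _ [].
have b3 w : B' (J3 w) = 'i%C *: B' w by case: (frame_quat_coord w) => _ _ _ _ [].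
apply/funext => -[z|].
  have := sphere_affine z; have := sphere_combE J1 J2 J3 (Some z).
  case: (sphere (Some z)) => [[a b] c] combE [e1 e2 c1].
  apply/seteqP; split=> w; rewrite eigensetE combE.
    move=> H; apply/(pencil_eqP fr).
    have := congr1 B' H; rewrite !linearD !linearZ /= b1 b2 b3 => HB.
    apply/rowP => j; have := congr1 (fun v : Cn => v 0 j) HB; rewrite !mxE mulrN => HBj.
    by have [[h _] _] := eigen_coord (A' w 0 j) (B' w 0 j) e1 e2 c1; apply: h.
  move/(pencil_eqP fr) => yx.
  have yxj j : B' w 0 j = z * A' w 0 j by rewrite yx mxE.
  apply: frame_ext; rewrite !linearD !linearZ /= ?a1 ?a2 ?a3 ?b1 ?b2 ?b3; apply/rowP => j;
      rewrite !mxE mulrN.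
    by have [_] := eigen_coord (A' w 0 j) (B' w 0 j) e1 e2 c1; apply.
  by have [[_ h] _] := eigen_coord (A' w 0 j) (B' w 0 j) e1 e2 c1; apply: h.
have i0 : 'i%C != 0 :> C by rewrite eq_complex /= oner_eq0 andbF.
apply/seteqP; split=> w; rewrite eigensetE sphere_combE /= !scale0r !add0r scale1r.
  move=> H; have A'i : A' ('i%C *: w) = 'i%C *: A' w by exact: linearZ.
  have := congr1 A' H; rewrite a3 A'i => /eqP.
  rewrite eq_sym -addr_eq0 -scalerDr scaler_eq0 (negPf i0) /= -mulr2n.
  rewrite -(scaler_nat 2) scaler_eq0 pnatr_eq0 /= => /eqP A0.
  by exists (B' w) => //; rewrite -[RHS]sum A0 linear0 add0r.
case=> x _ <-; apply: frame_ext; first by rewrite a3 AB scaler0 oppr0 linearZ /= AB scaler0.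
by rewrite b3 [RHS]linearZ.
Qed.
End FrameQuat.

End ComplexQuaternions.

Section CQuatFrame.
Variable R : realType.
Local Notation C := R[i].

(** [A'] is a left inverse of [A] on all of [W], but an inverse only on [E]. *)
Lemma subspace_coordinates (W : vectType C) (E : {vspace W}) :
  exists (A : 'Hom('rV[C]_(\dim E), W)) (A' : 'Hom(W, 'rV[C]_(\dim E))),
    [/\ forall x, A x \in E, forall x, A' (A x) = x & forall w, w \in E -> A (A' w) = w].
Proof.
have [A AE] : exists A : 'Hom('rV[C]_(\dim E), W),
    forall x, A x = \sum_i x 0 i *: (vbasis E)`_i.
  apply: hom_of_linear => a x y; rewrite scaler_sumr -big_split /=.
  by apply: eq_bigr => i _; rewrite !mxE scalerDl scalerA.
have [A' A'E] : exists A' : 'Hom(W, 'rV[C]_(\dim E)),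
    forall w, A' w = \row_i coord (vbasis E) i w.
  by apply: hom_of_linear => a x y; apply/rowP => j; rewrite !mxE linearP.
exists A, A'; split=> [x|x|w wE].
- rewrite AE memv_suml // => i _; apply: memvZ; apply: vbasis_mem.
  by rewrite mem_nth // size_tuple.
- apply/rowP => j; rewrite A'E mxE AE coord_sum_free //.
  exact: basis_free (vbasisP E).
- by rewrite AE [RHS](coord_vbasis wE); apply: eq_bigr => i _; rewrite A'E mxE.
Qed.

(** The involution T = - i J1 anticommutes with J3, so it exchanges the
    eigenspaces of J3 for - i and i. These span [W], and so have half its
    dimension; a basis of the first one and its image under T form a frame. *)
Lemma cquat_frame (W : vectType C) (J1 J2 J3 : 'End(W)) (n : nat) :
  n = (\dim {:W})./2 -> cquat J1 J2 J3 ->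
  exists (A B : 'Hom('rV[C]_n, W)) (A' B' : 'Hom(W, 'rV[C]_n)),
    frame A B A' B' /\ frame_quat A B A' B' J1 J2 J3.
Proof.
move=> nE [j11 j22 j12 j21].
have ii (w : W) : 'i%C *: ('i%C *: w) = - w by exact: scale_ii.
have j13 w : J1 (J3 w) = - J2 w by rewrite -j12 j11.
have j31 w : J3 (J1 w) = J2 w by rewrite -j12 j21 linearN /= j13 opprK.
have j33 w : J3 (J3 w) = - w by rewrite -(j12 w) j31 j22.
have lN (J : 'End(W)) w : J (- w) = - J w by exact: linearN.
have lD (J : 'End(W)) v w : J (v + w) = J v + J w by exact: linearD.
have lZ (J : 'End(W)) c w : J (c *: w) = c *: J w by exact: linearZ.
have lB (J : 'End(W)) v w : J (v - w) = J v - J w by exact: linearB.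
pose T : 'End(W) := (- 'i%C *: J1)%VF.
have TE w : T w = - ('i%C *: J1 w) by rewrite scale_lfunE scaleNr.
have TT w : T (T w) = w.
  by rewrite !TE lN lZ j11 scalerN opprK ii opprK.
have TJ w : J3 (T w) = - T (J3 w).
  by rewrite !TE lN lZ j31 j13 scalerN opprK.
(* the projection onto the eigenspace E0 of J3 for - i *)
pose pi0 : 'End(W) := (2%:R^-1 *: (\1 + 'i%C *: J3))%VF.
have pi0E w : pi0 w = 2%:R^-1 *: (w + 'i%C *: J3 w).
  by rewrite scale_lfunE add_lfunE id_lfunE scale_lfunE.
pose E0 := lker (J3 + 'i%C *: \1)%VF.
have E0P w : (w \in E0) = (J3 w == - ('i%C *: w)).
  by rewrite memv_ker add_lfunE scale_lfunE id_lfunE addr_eq0.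
have half (w : W) : 2%:R^-1 *: (w + w) = w by exact: half_double.
have pi0_in w : pi0 w \in E0.
  rewrite E0P pi0E lZ lD lZ j33 scalerN; apply/eqP.
  rewrite (scalerA 'i%C) (mulrC 'i%C) -scalerA -(scalerN 2%:R^-1).
  by rewrite (scalerDr 'i%C) ii opprD opprK [X in _ = _ *: X]addrC.
have pi0_id w : w \in E0 -> pi0 w = w.
  by rewrite E0P pi0E => /eqP ->; rewrite scalerN ii opprK half.
have pi0_T w : w \in E0 -> pi0 (T w) = 0.
  rewrite E0P pi0E TJ => /eqP ->; rewrite lN lZ opprK ii.
  by rewrite subrr scaler0.
have pi0_sum w : pi0 w + T (pi0 (T w)) = w.
  rewrite !pi0E TJ lZ lD TT lZ lN TT scalerN -scalerDr.
  by rewrite addrACA subrr addr0 half.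
have pi0_dif w : T (pi0 (T w)) - pi0 w = - ('i%C *: J3 w).
  rewrite !pi0E TJ lZ lD TT lZ lN TT scalerN -scalerBr.
  by rewrite opprD addrACA subrr add0r -opprD scalerN half.
have kerT : lker T = 0%VS by apply/eqP/lker0P; apply: can_inj TT.
have dimE0 : \dim E0 = n.
  have sumE : (E0 + T @: E0)%VS = fullv.
    apply/vspaceP => w; rewrite memvf -(pi0_sum w).
    by rewrite memv_add // memv_img.
  have capE : (E0 :&: T @: E0)%VS = 0%VS.
    apply/eqP; rewrite -subv0; apply/subvP => w; rewrite memv_cap memv0.
    case/andP=> wE /memv_imgP[v vE wv].
    by rewrite -(pi0_id w wE) wv pi0_T.
  rewrite nE -sumE dimv_disjoint_sum // limg_dim_eq ?kerT ?capv0 //.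
  by rewrite addnn doubleK.
have [A [Ai [AE AiA AAi]]] := subspace_coordinates E0.
rewrite -dimE0.
exists A, (T \o A)%VF, (Ai \o pi0)%VF, (Ai \o pi0 \o T)%VF.
split.
  split=> [x|x|x|x|w]; rewrite !comp_lfunE /=.
  - by rewrite pi0_id.
  - by rewrite pi0_T // linear0.
  - by rewrite pi0_T // linear0.
  - by rewrite TT pi0_id.
  - by rewrite !AAi.
move=> w; rewrite !comp_lfunE /= !AAi //.
have T1 v : J1 v = 'i%C *: T v by rewrite TE scalerN ii opprK.
have t1 : T (pi0 w) + pi0 (T w) = T w.
  by rewrite -{1}(TT (pi0 (T w))) -lD pi0_sum.
have t2 : T (T (pi0 (T w))) - T (pi0 w) = T (- ('i%C *: J3 w)).
  by rewrite -pi0_dif lB.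
split.
- by rewrite t1 T1.
- rewrite -{1}(TT (pi0 (T w))) t2 TE lN lZ j13 !scalerN !opprK ii opprK //.
- by rewrite pi0_dif scalerN ii opprK.
Qed.

Lemma coord_ext (K : fieldType) (U : vectType K) (u v : U) :
  (forall k, coord (vbasis fullv) k u = coord (vbasis fullv) k v) -> u = v.
Proof.
move=> uv; rewrite (coord_vbasis (memvf u)) (coord_vbasis (memvf v)).
by apply: eq_bigr => k _; rewrite uv.
Qed.

Section SphereComb.
Variables (W : vectType C) (J1 J2 J3 : 'End(W)).
Hypothesis jq : cquat J1 J2 J3.
Local Notation comb := (sphere_comb J1 J2 J3).

Lemma eigenset_iZ p w : eigenset J1 J2 J3 p w -> eigenset J1 J2 J3 p ('i%C *: w).
Proof. by rewrite !eigensetE => e; rewrite [LHS]linearZ /= e. Qed.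

Lemma sphere_comb_antipode p w : comb (antipode p) w = - comb p w.
Proof.
rewrite !sphere_combE sphere_antipode; case: (sphere p) => [[a b] c].
by rewrite !rmorphN !scaleNr !opprD.
Qed.

Lemma sphere_comb_sqr p w : comb p (comb p w) = - w.
Proof.
have [j11 j22 j12 j21] := jq.
have j13 v : J1 (J3 v) = - J2 v by rewrite -j12 j11.
have j31 v : J3 (J1 v) = J2 v by rewrite -j12 j21 linearN /= j13 opprK.
have j33 v : J3 (J3 v) = - v by rewrite -(j12 v) j31 j22.
have j32 v : J3 (J2 v) = - J1 v by rewrite -j12 j22 linearN.
have j23 v : J2 (J3 v) = J1 v by rewrite -(j12 v) j21 j32 opprK.
(* an identity between combinations of w, J1 w, J2 w and J3 w, checked on
   coordinates *)
have := sphere_norm p; rewrite !sphere_combE; case: (sphere p) => [[a b] c] n1.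
rewrite !linearD !linearZ /= j11 j22 j33 j12 j21 j13 j31 j23 j32.
have {}n1 : a%:C ^+ 2 + b%:C ^+ 2 + c%:C ^+ 2 = 1 :> C by rewrite -!rmorphXn -!rmorphD n1.
apply: coord_ext => k.
pose l (v : W) := coord (vbasis fullv) k v.
have lD v v' : l (v + v') = l v + l v' by exact: linearD.
have lZ x v : l (x *: v) = x * l v by exact: linearZ.
have lN v : l (- v) = - l v by exact: linearN.
rewrite -/(l _) -[in RHS]/(l _) !(lD, lZ, lN) -[RHS]mul1r -n1; ring.
Qed.
End SphereComb.
End CQuatFrame.

(** * Complexifications *)

Section Cplx.
Variable R : realType.
Local Notation C := R[i].
Variable U : vectType R.
Implicit Types (v w : cplx U).

Lemma cplx_realZ (a : R) v : a%:C *: v = (a *: v.1, a *: v.2) :> cplx U.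
Proof. by rewrite /GRing.scale /= /cplx_scale /= !scale0r subr0 addr0. Qed.

Lemma cplx_iZ v : 'i%C *: v = (- v.2, v.1) :> cplx U.
Proof. by rewrite /GRing.scale /= /cplx_scale /= !scale0r !scale1r sub0r add0r. Qed.

Lemma cplx_scaleE (a : C) v : a *: v = (complex.Re a)%:C *: v + (complex.Im a)%:C *: ('i%C *: v).
Proof. by rewrite scalerA -scalerDl {1}[a]complexE mulrC. Qed.

Lemma T10P (J : 'End(U)) v : T10 J v <-> v.2 = - J v.1.
Proof.
split=> [[x _ <-]|].
  by rewrite cplx_iZ /= oppr0 subr0 add0r.
case: v => x y /= ->; exists x => //; rewrite cplx_iZ /=.
by congr pair; rewrite /= ?oppr0 ?subr0 ?add0r // addr0.
Qed.

Lemma T10_inj (J J' : 'End(U)) : T10 J = T10 J' -> J = J'.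
Proof.
move=> JJ'; apply/lfunP => x.
have : T10 J (x, - J x) by apply/T10P.
by rewrite JJ' => /T10P /= /oppr_inj.
Qed.

(** (x, - J x) and its multiple (J x, x) both lie on the graph of - J. *)
Lemma T10_i_complex_structure (J : 'End(U)) :
  (forall v, T10 J v -> T10 J ('i%C *: v)) -> complex_structure J.
Proof.
move=> Ji; apply/lfunP => x.
have /Ji : T10 J (x, - J x) by apply/T10P.
rewrite cplx_iZ => /T10P /=; rewrite opprK => xJJ.
by rewrite comp_lfunE opp_lfunE id_lfunE {2}xJJ opprK.
Qed.

Lemma cplx_linear_of_real (J : 'End(realif U)) :
  (forall v, act J ('i%C *: v) = 'i%C *: act J v) ->
  exists L : 'End(cplx U), forall v, L v = act J v.
Proof.
move=> Ji; apply: hom_of_linear => a v w.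
have JD (x y : cplx U) : act J (x + y) = act J x + act J y.
  exact: (linearD J (x : realif U) (y : realif U)).
have JR (r : R) (x : cplx U) : act J (r%:C *: x) = r%:C *: act J x.
  rewrite !cplx_realZ (_ : (r *: x.1, r *: x.2) = r *: (x : realif U)) //.
  by rewrite /act linearZ.
by rewrite JD (cplx_scaleE a v) (cplx_scaleE a (act J v)) JD !JR Ji.
Qed.

Lemma real_of_cplx_linear (L : 'End(cplx U)) :
  exists J : 'End(realif U), forall v, act J v = L v.
Proof.
apply: (@hom_of_linear R (realif U) (realif U) (L : cplx U -> cplx U)) => a v w.
have -> : (a *: v + w : realif U) = (a%:C *: (v : cplx U) + w : cplx U).
  by rewrite cplx_realZ.
by rewrite linearP /= cplx_realZ.
Qed.

Lemma complexification (J : 'End(U)) :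
  exists L : 'End(cplx U), forall v, L v = (J v.1, J v.2).
Proof.
apply: hom_of_linear => -[a b] v w; rewrite /GRing.scale /= /cplx_scale /=.
by congr pair; rewrite /= !linearD /= ?linearN /= !linearZ.
Qed.

Lemma pluricomplex_of_frame (K : P1 R -> 'End(U))
    (A B : 'Hom('rV[C]_((\dim {:U})./2), cplx U)) A' B' :
  frame A B A' B' -> (fun p => T10 (K p)) = pencil A B ->
  (forall p v, T10 (K p) v -> T10 (K p) ('i%C *: v)) -> pluricomplex K.
Proof.
move=> fr KE Ki; have KEp p : T10 (K p) = pencil A B p by rewrite -KE.
split.
- by move=> p; apply: T10_i_complex_structure; apply: Ki.
- rewrite (_ : (fun z => _) = (fun z => range (fun x => A x + z *: B x))).
    exact: frame_graph_holomorphic fr.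
  by apply/funext => z; rewrite KEp.
- rewrite (_ : (fun z => _) = (fun z => range (fun x => B x + z *: A x))).
    exact: frame_graph_holomorphic (frame_swap fr).
  by apply/funext => z; rewrite KEp pencil_chart1.
- by apply: (frame_sub_iso fr); apply/funext.
- by apply: (frame_quotient_iso fr); apply/funext.
Qed.

Lemma frame_of_pluricomplex (K : P1 R -> 'End(U)) : pluricomplex K ->
  exists (A B : 'Hom('rV[C]_((\dim {:U})./2), cplx U)) A' B',
    frame A B A' B' /\ (fun p => T10 (K p)) = pencil A B.
Proof.
case=> _ _ _ [f0 [f1 [hf0 hf1 f01 f0P f1P]]] [g0 [g1 [hg0 hg1 g01 g0P g1P]]].
have f0E z : f0 z = f0 0 + z *: f1 0.
  apply: section_O1_affine_vect => // {}z z0; apply/lfunP => v.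
  by rewrite f01 // opprK expr1z linearZ scale_lfunE.
have g0E z : g0 z = g0 0 + z *: g1 0.
  apply: section_O1_affine_vect => // {}z z0; apply/lfunP => v.
  by rewrite scale_lfunE g01 // -/(z^-1) scalerA mulfV // scale1r.
have rangeE z : range (f0 z) = range (fun x => f0 0 x + z *: f1 0 x).
  by apply: eq_range => x; rewrite {1}f0E add_lfunE scale_lfunE.
have T0 : chart1 (0 : C) = None by rewrite /chart1 eqxx.
have KN : range (f1 0) = T10 (K None) by have [_ ->] := f1P 0; rewrite T0.
have [z x y||z||A' [B' fr]] := @frame_of_pencil R (cplx U) _ (f0 0) (f1 0) (g0 0) (g1 0).
- have [inj _] := f0P z; rewrite -!scale_lfunE -!add_lfunE -f0E; exact: inj.
- by case: (f1P 0).
- rewrite -rangeE; have [_ ->] := f0P z; have [_ <-] := g0P z.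
  by apply/funext => w; rewrite /= [in RHS]g0E add_lfunE scale_lfunE.
- by have [_ ->] := f1P 0; have [_ <-] := g1P 0.
exists (f0 0), (f1 0), A', B'; split=> //.
apply/funext => -[z|] //=; rewrite -rangeE.
by have [_ ->] := f0P z.
Qed.

(** The complexifications of I1, I2, I3 are quaternionic on the complexification
    of [U], with the (1,0)-spaces as their eigenspaces. So the bundle conditions
    in the definition of a hypercomplex structure are automatic. *)
Lemma pluricomplex_of_quaternionic (K : P1 R -> 'End(U)) (I1 I2 I3 : 'End(U)) :
  quaternionic I1 I2 I3 ->
  (forall p, let: (a, b, c) := sphere p in K p = a *: I1 + b *: I2 + c *: I3) ->
  pluricomplex K.
Proof.
move=> [q1 q2 q12 q21] KE.
have I11 x : I1 (I1 x) = - x by rewrite -comp_lfunE q1 opp_lfunE id_lfunE.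
have I22 x : I2 (I2 x) = - x by rewrite -comp_lfunE q2 opp_lfunE id_lfunE.
have I12 x : I1 (I2 x) = I3 x by rewrite -comp_lfunE q12.
have I21 x : I2 (I1 x) = - I3 x by rewrite -comp_lfunE q21 opp_lfunE.
have [J1 J1E] := complexification I1.
have [J2 J2E] := complexification I2.
have [J3 J3E] := complexification I3.
have jq : cquat J1 J2 J3.
  by split=> v; rewrite ?J1E ?J2E /= ?J1E ?J2E ?J3E /= ?I11 ?I22 ?I12 ?I21.
have combE p v : sphere_comb J1 J2 J3 p v = (K p v.1, K p v.2).
  have := KE p; rewrite sphere_combE; case: (sphere p) => [[a b] c] ->.
  rewrite J1E J2E J3E !cplx_realZ /=.
  by rewrite !add_lfunE !scale_lfunE.
have T10E p : T10 (K p) = eigenset J1 J2 J3 p.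
  apply/seteqP; split=> v; rewrite eigensetE combE cplx_iZ.
    move/T10P => v2; congr pair; rewrite v2 ?opprK // linearN /=.
    have := congr1 fst (sphere_comb_sqr jq p (v.1, 0)); rewrite !combE /= => ->.
    by rewrite opprK.
  by case=> v2 _; apply/T10P; rewrite v2 opprK.
have dimU : (\dim {:U})./2 = (\dim {:cplx U})./2 by rewrite !dimvf.
have [A [B [A' [B' [fr fq]]]]] := cquat_frame dimU jq.
apply: (@pluricomplex_of_frame K A B A' B') => //.
  by apply/funext => p; rewrite T10E (eigenset_pencil fr fq).
by move=> p v; rewrite T10E; apply: eigenset_iZ.
Qed.

(** Let pi project, up to a factor 2, onto the i-eigenspace E of L. If V meets
    neither E nor the eigenspace for - i, the real part of pi is injective on V,
    hence bijective: every x in V is the real part of some vector of E, and of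
    only one, whose imaginary part is - J x. No dimensions are counted. *)
Lemma real_structure (L : 'End(cplx U)) :
  (forall v, L (L v) = - v) ->
  (forall x, L (of_real x) = 'i%C *: of_real x -> x = 0) ->
  (forall x, L (of_real x) = - ('i%C *: of_real x) -> x = 0) ->
  exists J : 'End(U), T10 J = [set v | L v = 'i%C *: v].
Proof.
move=> LL Lp Lm.
pose pi (v : cplx U) : cplx U := v - 'i%C *: L v.
have piE v : L (pi v) = 'i%C *: pi v.
  by rewrite /pi linearB linearZ /= LL scalerBr scale_ii opprK scalerN opprK addrC.
have pi_lin (a : R) (x y : U) : pi (of_real (a *: x + y)) = a%:C *: pi (of_real x) + pi (of_real y).
  have -> : of_real (a *: x + y) = a%:C *: of_real x + of_real y :> cplx U.
    by rewrite cplx_realZ /of_real /= scaler0; congr pair; rewrite /= addr0.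
  rewrite /pi linearP /= scalerDr scalerBr !scalerA (mulrC 'i%C) opprD addrACA -scalerA;
      congr (_ + _).
have [m mE] : exists m : 'End(U), forall x, m x = (pi (of_real x)).1.
  by apply: hom_of_linear => a x y; rewrite pi_lin cplx_realZ.
have [h hE] : exists h : 'End(U), forall x, h x = (pi (of_real x)).2.
  by apply: hom_of_linear => a x y; rewrite pi_lin cplx_realZ.
have im_eq0 (y : U) : L (0, y) = 'i%C *: ((0, y) : cplx U) -> y = 0.
  have -> : (0, y) = 'i%C *: of_real y :> cplx U by rewrite cplx_iZ /of_real /= oppr0.
  rewrite linearZ /= => /(congr1 ( *:%R (- 'i%C))).
  by rewrite !scaleNr !scale_ii !opprK => /Lp.
have m_inj : lker m == 0%VS.
  apply/lker0P => x1 x2 /eqP; rewrite -subr_eq0 -linearB /= => /eqP; rewrite mE => m0.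
  apply/eqP; rewrite -subr_eq0; apply/eqP; set x := x1 - x2 in m0 *.
  have y0 : (pi (of_real x)).2 = 0.
    by apply: im_eq0; rewrite -m0 -surjective_pairing piE.
  have : pi (of_real x) = 0 by rewrite [LHS]surjective_pairing m0 y0.
  move=> /eqP; rewrite subr_eq0 => /eqP e; apply: Lm.
  by rewrite {2}e scale_ii opprK.
exists (- (h \o m^-1))%VF.
apply/seteqP; split=> v.
  move/T10P; rewrite opp_lfunE comp_lfunE opprK hE => v2.
  have v1 : v.1 = (pi (of_real ((m^-1)%VF v.1))).1 by rewrite -mE lker0_lfunVK.
  have -> : v = pi (of_real ((m^-1)%VF v.1)).
    by rewrite [LHS]surjective_pairing [RHS]surjective_pairing -v1 -v2.
  exact: piE.
move=> /= Lv; apply/T10P; rewrite opp_lfunE comp_lfunE opprK hE.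
set u := pi _.
have u1 : u.1 = v.1 by rewrite -mE lker0_lfunVK.
apply/eqP; rewrite -subr_eq0; apply/eqP; apply: im_eq0.
have -> : (0, v.2 - u.2) = v - u :> cplx U.
  by rewrite (_ : v - u = (v.1 - u.1, v.2 - u.2)) // u1 subrr.
by rewrite linearB /= Lv [L u]piE -/u [in RHS]scalerBr.
Qed.

End Cplx.

(** * The correspondence *)

Section Correspondence.
Variable R : realType.
Local Notation C := R[i].
Variable V : vectType R.

(** For a complex structure that commutes with i, the vectors X - i J X are the
    eigenvectors of J for i. *)
Lemma intrinsic_T10E (J : 'End(realif V)) (L : 'End(cplx V)) :
  (forall v, act J v = L v) -> (forall v, L (L v) = - v) ->
  intrinsic_T10 J = [set v | L v = 'i%C *: v].
Proof.
move=> JL LL; apply/seteqP; split=> [_ [v _ <-]|v Lv] /=.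
  by rewrite JL linearB linearZ /= LL scalerBr scale_ii opprK scalerN opprK addrC.
exists (2%:R^-1 *: v) => //; rewrite JL [L (_ *: _)]linearZ /= Lv scalerA mulrC -scalerA scale_ii.
by rewrite scalerN opprK -scalerDr half_double.
Qed.

(** The common form of both sides of the correspondence: the (1,0)-spaces of
    [K] are the eigenspaces of a quaternionic structure on V^C. *)
Definition cquat_T10 (K : P1 R -> 'End(V)) (J1 J2 J3 : 'End(cplx V)) :=
  cquat J1 J2 J3 /\ forall p, T10 (K p) = eigenset J1 J2 J3 p.

Lemma pluricomplex_cquat (K : P1 R -> 'End(V)) : pluricomplex K ->
  exists J1 J2 J3, cquat_T10 K J1 J2 J3.
Proof.
move=> /frame_of_pluricomplex[A [B [A' [B' [fr KE]]]]].
have [J1 [J2 [J3 fq]]] := frame_quat_exists A B A' B'.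
exists J1, J2, J3; split; first exact: frame_cquat fr fq.
by move=> p; rewrite (eigenset_pencil fr fq) -KE.
Qed.

Lemma cquat_pluricomplex (K : P1 R -> 'End(V)) J1 J2 J3 :
  cquat_T10 K J1 J2 J3 -> pluricomplex K.
Proof.
move=> [jq KE].
have dimV : (\dim {:V})./2 = (\dim {:cplx V})./2 by rewrite !dimvf.
have [A [B [A' [B' [fr fq]]]]] := cquat_frame dimV jq.
apply: (@pluricomplex_of_frame _ _ K A B A' B') => //.
  by apply/funext => p; rewrite KE (eigenset_pencil fr fq).
by move=> p v; rewrite KE; apply: eigenset_iZ.
Qed.

(** The antipode changes the sign of the quaternion, so its i-eigenspace is the
    eigenspace for - i of the original one. *)
Lemma eigenset_antipode (W : vectType C) (J1 J2 J3 : 'End(W)) p v :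
  eigenset J1 J2 J3 (antipode p) v <-> sphere_comb J1 J2 J3 p v = - ('i%C *: v).
Proof.
rewrite eigensetE sphere_comb_antipode; split=> [<-|->]; by rewrite opprK.
Qed.

Lemma eigenset_direct_sum (W : vectType C) (J1 J2 J3 : 'End(W)) p : cquat J1 J2 J3 ->
  direct_sum (eigenset J1 J2 J3 p) (eigenset J1 J2 J3 (antipode p)).
Proof.
move=> jq v.
pose L := sphere_comb J1 J2 J3 p.
have LL w : L (L w) = - w by exact: sphere_comb_sqr.
have lZ a w : L (a *: w) = a *: L w by exact: linearZ.
have lD w w' : L (w + w') = L w + L w' by exact: linearD.
have lB w w' : L (w - w') = L w - L w' by exact: linearB.
have iV (w : W) : 'i%C *: (2%:R^-1 *: w) = 2%:R^-1 *: ('i%C *: w).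
  by rewrite !scalerA mulrC.
exists (2%:R^-1 *: (v - 'i%C *: L v), 2%:R^-1 *: (v + 'i%C *: L v)); split=> /=.
  split.
  - rewrite eigensetE -/L lZ lB lZ LL iV (scalerBr 'i%C) scale_ii.
    by rewrite opprK scalerN opprK addrC.
  - apply/eigenset_antipode; rewrite -/L lZ lD lZ LL iV (scalerDr 'i%C) scale_ii.
    by rewrite -(scalerN 2%:R^-1) opprB scalerN.
  - by rewrite -scalerDr addrACA addNr addr0 half_double.
move=> [v1 v2] /= [e1 /eigenset_antipode e2 ->].
rewrite eigensetE -/L in e1; rewrite -/L in e2.
rewrite lD e1 e2 (scalerBr 'i%C) !scale_ii opprB.
rewrite !opprK; congr pair; first by rewrite (addrC (- v2)) addrACA subrr addr0 half_double.
by rewrite addrACA subrr add0r half_double.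
Qed.

(** Choosing by the characterising property, rather than through a frame, makes
    the map independent of the trivialisations of the bundles. *)
Definition hyper_of (K : P1 R -> 'End(V)) (p : P1 R) : 'End(realif V) :=
  xget 0 [set J | forall v1 v2, T10 (K p) v1 -> T10 (K (antipode p)) v2 ->
                   act J (v1 + v2) = 'i%C *: (v1 - v2)].

Definition pluri_of (Kt : P1 R -> 'End(realif V)) (p : P1 R) : 'End(V) :=
  xget 0 [set J | T10 J = intrinsic_T10 (Kt p)].

Lemma pluri_ofE Kt p J : T10 J = intrinsic_T10 (Kt p) -> pluri_of Kt p = J.
Proof. by move=> JE; apply: xget_unique => // J' J'E; apply: T10_inj; rewrite J'E. Qed.

Lemma hyper_ofE K J1 J2 J3 p (J : 'End(realif V)) : cquat_T10 K J1 J2 J3 ->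
  (forall v, act J v = sphere_comb J1 J2 J3 p v) -> hyper_of K p = J.
Proof.
move=> [jq KE] JE; apply: xget_unique => [v1 v2|J' J'E].
  rewrite !KE => e1 /eigenset_antipode e2.
  by rewrite JE linearD /= e1 e2 scalerBr.
apply/lfunP => v.
have [[v1 v2] [[/= e1 e2 vE] _]] := eigenset_direct_sum p jq (v : cplx V).
rewrite -/(act J' v) -/(act J v) vE J'E ?KE // JE.
rewrite [sphere_comb _ _ _ _ _]linearD /= e1.
by have /eigenset_antipode -> := e2; rewrite scalerBr.
Qed.

Lemma hyper_of_transverse K : pluricomplex K ->
  exists J1 J2 J3, [/\ cquat_T10 K J1 J2 J3,
    forall p v, act (hyper_of K p) v = sphere_comb J1 J2 J3 p v &
    transverse_hypercomplex (hyper_of K)].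
Proof.
move=> Kpl; have [J1 [J2 [J3 Kq]]] := pluricomplex_cquat Kpl.
have [jq KE] := Kq; have [j11 j22 j12 j21] := jq.
have [I1 I1E] := real_of_cplx_linear J1.
have [I2 I2E] := real_of_cplx_linear J2.
have [I3 I3E] := real_of_cplx_linear J3.
pose Kt p : 'End(realif V) := let: (a, b, c) := sphere p in a *: I1 + b *: I2 + c *: I3.
have KtE p v : act (Kt p) v = sphere_comb J1 J2 J3 p v.
  rewrite /Kt sphere_combE; case: (sphere p) => [[a b] c].
  rewrite !cplx_realZ -I1E -I2E -I3E.
  by rewrite /act !add_lfunE !scale_lfunE.
have hE : hyper_of K = Kt by apply/funext => p; apply: hyper_ofE Kq (KtE p).
exists J1, J2, J3; rewrite hE; split=> //.
split.
- have Iq : quaternionic I1 I2 I3.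
    by split; apply/lfunP => v; rewrite !comp_lfunE ?opp_lfunE ?id_lfunE;
      rewrite -?/(act _ _) ?I1E ?I2E ?I3E ?I1E ?I2E ?I3E ?j11 ?j22 ?j12 ?j21.
  have KtI p : let: (a, b, c) := sphere p in Kt p = a *: I1 + b *: I2 + c *: I3.
    by rewrite /Kt; case: (sphere p) => [[a b] c].
  split; first by apply: (pluricomplex_of_quaternionic Iq) => p; have := KtI p; case:
      (sphere p) => [[a b] c].
  by exists I1, I2, I3; split=> // p; have := KtI p; case: (sphere p) => [[a b] c].
- by move=> p v; rewrite !KtE linearZ.
move=> p.
rewrite (intrinsic_T10E (KtE p) (sphere_comb_sqr jq p)) -/(eigenset J1 J2 J3 p) -KE.
apply/seteqP; split=> [_ [[x _ <-] /T10P /= xK]|_ ->] /=; last first.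
  split; first by exists 0.
  by apply/T10P; rewrite /= linear0 oppr0.
have Kx : K p x = 0 by apply/eqP; rewrite -oppr_eq0 -xK.
have := pluri_cs Kpl p => /lfunP/(_ x); rewrite comp_lfunE opp_lfunE id_lfunE Kx linear0.
by move=> /eqP; rewrite eq_sym oppr_eq0 => /eqP ->.
Qed.

(** The maps I1, I2, I3 are the values at 1, i and infinity, so they commute
    with i as all the values do. *)
Lemma transverse_cquat Kt : transverse_hypercomplex Kt ->
  exists J1 J2 J3 : 'End(cplx V), cquat J1 J2 J3 /\
    forall p v, act (Kt p) v = sphere_comb J1 J2 J3 p v.
Proof.
move=> [[_ [I1 [I2 [I3 [[q1 q2 q12 q21] KtE]]]]] comm _].
have two : (2%:R : R) / (1 + 1) = 1 by rewrite divff.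
have I1K : I1 = Kt (Some 1).
  have -> := KtE (Some 1); rewrite expr1n expr0n /= !addr0 !mulr1 mulr0 mul0r subrr mul0r two.
  by rewrite !scale0r !addr0 scale1r.
have I2K : I2 = Kt (Some 'i%C).
  have -> := KtE (Some 'i%C); rewrite expr1n expr0n /= !add0r !mulr1 mulr0 mul0r subrr mul0r two.
  by rewrite !scale0r add0r addr0 scale1r.
have I3K : I3 = Kt None.
  by have := KtE None; rewrite /= !scale0r !add0r scale1r.
have [J1 J1E] : exists L : 'End(cplx V), forall v, L v = act I1 v.
  by apply: cplx_linear_of_real => v; rewrite I1K; apply: comm.
have [J2 J2E] : exists L : 'End(cplx V), forall v, L v = act I2 v.
  by apply: cplx_linear_of_real => v; rewrite I2K; apply: comm.
have [J3 J3E] : exists L : 'End(cplx V), forall v, L v = act I3 v.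
  by apply: cplx_linear_of_real => v; rewrite I3K; apply: comm.
exists J1, J2, J3; split.
  split=> v; rewrite ?J1E ?J2E ?J3E ?J1E ?J2E /act -?comp_lfunE ?q1 ?q2 ?q12 ?q21;
    by rewrite ?opp_lfunE ?id_lfunE.
move=> p v; have := KtE p; rewrite sphere_combE; case: (sphere p) => [[a b] c] ->.
by rewrite J1E J2E J3E !cplx_realZ /act !add_lfunE !scale_lfunE.
Qed.

(** Transversality at a point and at its antipode are the two hypotheses of
    [real_structure]. *)
Lemma pluri_of_cquat Kt : transverse_hypercomplex Kt ->
  exists J1 J2 J3, [/\ cquat_T10 (pluri_of Kt) J1 J2 J3,
    forall p v, act (Kt p) v = sphere_comb J1 J2 J3 p v &
    forall p, T10 (pluri_of Kt p) = intrinsic_T10 (Kt p)].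
Proof.
move=> Kth; have [J1 [J2 [J3 [jq KtE]]]] := transverse_cquat Kth.
have tE p : intrinsic_T10 (Kt p) = eigenset J1 J2 J3 p.
  exact: intrinsic_T10E (KtE p) (sphere_comb_sqr jq p).
have tr p (x : V) : eigenset J1 J2 J3 p (of_real x) -> x = 0.
  rewrite -tE => xE; have : [set (0 : cplx V)] (of_real x).
    by rewrite -(th_transverse Kth p); split=> //; exists x.
  by case.
have pE p : T10 (pluri_of Kt p) = intrinsic_T10 (Kt p).
  have [J JE] : exists J : 'End(V), T10 J = eigenset J1 J2 J3 p.
    apply: real_structure => [v|x|x]; first exact: sphere_comb_sqr.
      exact: tr.
    by move=> /eigenset_antipode; apply: tr.
  by rewrite -tE in JE; rewrite (pluri_ofE JE).
by exists J1, J2, J3; split=> //; split=> // p; rewrite pE tE.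
Qed.

End Correspondence.

Theorem theorem4p2 (R : realType) (V : vectType R)
    (evenV : ~~ odd (\dim {:V})) :
  (forall K : P1 R -> 'End(V), pluricomplex K ->
     forall p, direct_sum (T10 (K p)) (T10 (K (antipode p)))) /\
  exists (Phi : (P1 R -> 'End(V)) -> (P1 R -> 'End(realif V)))
         (Psi : (P1 R -> 'End(realif V)) -> (P1 R -> 'End(V))),
    [/\ (forall K, pluricomplex K ->
           transverse_hypercomplex (Phi K) /\ Psi (Phi K) = K),
        (forall Kt, transverse_hypercomplex Kt ->
           pluricomplex (Psi Kt) /\ Phi (Psi Kt) = Kt),
        (forall K, pluricomplex K ->
           forall p v1 v2, T10 (K p) v1 -> T10 (K (antipode p)) v2 ->
             act (Phi K p) (v1 + v2) = 'i%C *: (v1 - v2)) &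
        (forall Kt, transverse_hypercomplex Kt ->
           forall p, T10 (Psi Kt p) = intrinsic_T10 (Kt p))].
Proof.
split=> [K /pluricomplex_cquat[J1 [J2 [J3 [jq KE]]]] p|].
  by rewrite !KE; apply: eigenset_direct_sum.
exists (@hyper_of R V), (@pluri_of R V); split.
- move=> K /hyper_of_transverse[J1 [J2 [J3 [[jq KE] hE th]]]]; split=> //.
  apply/funext => p; apply: pluri_ofE; rewrite KE.
  by rewrite (intrinsic_T10E (hE p) (sphere_comb_sqr jq p)).
- move=> Kt /pluri_of_cquat[J1 [J2 [J3 [Kq KtE _]]]]; split.
    exact: cquat_pluricomplex Kq.
  by apply/funext => p; apply: hyper_ofE Kq (KtE p).
- move=> K /hyper_of_transverse[J1 [J2 [J3 [[jq KE] hE _]]]] p v1 v2.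
  rewrite !KE => e1 /eigenset_antipode e2.
  by rewrite hE linearD /= e1 e2 scalerBr.
- by move=> Kt /pluri_of_cquat[J1 [J2 [J3 [_ _ pE]]]].
Qed.
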